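(* Let $a\in\mathbf{R}$, $\tau^*>0$, $L\ge 0$, and let $f\in L^2(\mathbf{R})$ satisfy $\operatorname{supp} f\subset[-L,\infty)$. Suppose that $$\int_0^{\tau^*}\big(U_a(\tau^*-s)[\,w(s,\cdot)f(\cdot)\,]\big)(y)\,ds=0\quad\text{for (almost) every } y\in\mathbf{R}.$$ Then $f=0$ almost everywhere on $\mathbf{R}$. Equivalently, a solution $f$ of the integral equation $v(\tau^*,y)=\int_0^{\tau^*}U_a(\tau^*-s)[w(s,\cdot)f(\cdot)](y)\,ds$ with given left-hand side is unique.
   Context: Fix $a\in\mathbf{R}$ (in the paper's application $a=\frac{\sigma_0^2-2\mu_0}{2\sigma_0^2}-1$ for a constant volatility $\sigma_0>0$ and constant drift $\mu_0$, but $a$ is an arbitrary real constant here). For $\tau>0$ and $y\in\mathbf{R}$ let $K_a(\tau,y)=\frac{1}{\sqrt{4\pi\tau}}\exp\!\big(-\frac{|y|^2}{4\tau}+ay\big)$, and define the operator $(U_a(\tau)\varphi)(y)=\int_{\mathbf{R}}K_a(\tau,y-x)\varphi(x)\,dx$. Define $w(\tau,x)=\int_0^\infty K_a(\tau,x-y)\,dy$ for $\tau>0$, $x\in\mathbf{R}$ (equivalently $w(\tau,x)=\pi^{-1/2}e^{\tau a^2}\int_{-\infty}^{(x-2\tau a)/\sqrt{4\tau}}e^{-\theta^2}d\theta$); $w$ is the solution of $(\partial_\tau+H_a)w=0$, $w(0,\cdot)=1_{[0,\infty)}$, where $H_a=-(\frac{d}{dy}-a)^2$. The integral $\int_0^{\tau^*}U_a(\tau^*-s)[w(s,\cdot)f]\,ds$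 is the value at time $\tau^*$ of the solution $v$ of $(\partial_\tau+H_a)v=f(y)w(\tau,y)$, $v(0,\cdot)=0$; this is the linearized inverse problem of recovering the drift perturbation $f$ from $v(\tau^*,\cdot)$. *)

(* Defs.v *)
From HB Require Import structures.
From mathcomp Require Import all_boot all_order all_algebra.
From mathcomp Require Import all_classical all_reals all_analysis.
Set Implicit Arguments. Unset Strict Implicit. Unset Printing Implicit Defensive.
Import Order.TTheory GRing.Theory Num.Theory.
Import numFieldNormedType.Exports.
Local Open Scope classical_set_scope.
Local Open Scope ring_scope.

Section HeatDefs.
Variable R : realType.
Notation mu := (@lebesgue_measure R).

Definition Ka (a tau y : R) : R :=
  (Num.sqrt (4 * pi * tau))^-1 * expR (- (y ^+ 2) / (4 * tau) + a * y).

Definition Ua (a tau : R) (phi : R -> R) (y : R) : R :=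
  Rintegral mu setT (fun x => Ka a tau (y - x) * phi x).

Definition wa (a tau x : R) : R :=
  Rintegral mu `[0, +oo[%classic (fun y => Ka a tau (x - y)).

Definition Va (a taus : R) (f : R -> R) (y : R) : R :=
  Rintegral mu `]0, taus[%classic (fun s => Ua a (taus - s) (fun x => wa a s x * f x) y).

Definition L2 (f : R -> R) : Prop :=
  measurable_fun setT f /\ (\int[mu]_x ((f x) ^+ 2)%:E < +oo)%E.
End HeatDefs.

(* Main.v *)
(* If [v(T)] vanishes, its bilateral Laplace transform against [e^((m-a)y)] does too,
   and the heat kernel turns it into [int f(x) e^((m-a)x) int_0^T e^(-m^2 s) w(s,x) ds dx].
   Extending the time integral to [0, +oo) makes it explicit (exponentials in [x]) at the
   price of an error [O(e^(-m^2 T))].  So some function [g] built linearly from [f] has a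
   Laplace transform of size [O(e^(bp - T p^2))], and Phragmen's inversion formula gives
   [g = 0].
   With [m = -p], [g = 0] reads [2 e^(-au) f(u) = f(u/2)/2 + a int_0^(u/2) f] for [u > 0],
   a contraction in [L^1(0, d)] for small [d], which then propagates from [(0, d)] to
   [(0, 2d)]: hence [f = 0] on the positive half-line.  Then [m = p] gives [f = 0] on the
   negative half-line, where the transform is simply [int f(x) e^(2px) dx]. *)

(* The time factor depends on [m] only through m^2, so m = p and m = -p test [f] against the same
   [w]-transform, with opposite growth in x. Only m = -p is available at first: [f] is merely square
   integrable near +oo, so e^((p-a)x) f need not be integrable, whereas the support in [-L, +oo)
   makes e^(-(p+a)x) f integrable at the cost of a factor e^(Lp). Clearing the positive half-line is
   what makes m = p usable.

   With m = -p, all x <= 0 receive the same weight, proportional to 1 - a/p, so the negative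
   half-line is seen only through its total mass [A]. The constant 1 is the transform of a point
   mass at u = 0, which cannot belong to a function [g]; it is carried separately, and [A = 0] comes
   out only after [g = 0]. This removes the negative half-line from the integral term of the
   functional equation.

   The size of the error matters: e^(-T p^2) beats e^(pt) for every t, so [g] vanishes on the whole
   half-line. A bound e^(-cp) would only control an initial interval. *)
Require Import Defs.
From HB Require Import structures.
From mathcomp Require Import all_boot all_order all_algebra.
From mathcomp Require Import all_classical all_reals all_analysis.
From mathcomp Require Import measurable_realfun ring lra.
Import Order.TTheory GRing.Theory Num.Theory.
Import numFieldNormedType.Exports.
Local Open Scope classical_set_scope.
Local Open Scope ring_scope.
Set Implicit Arguments.
Unset Strict Implicit.

(** * Fubini for real-valued integrals *)

Section RealFubini.
Context d1 d2 (T1 : measurableType d1) (T2 : measurableType d2) (R : realType).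
Variable m1 : {sigma_finite_measure set T1 -> \bar R}.
Variable m2 : {sigma_finite_measure set T2 -> \bar R}.
Variable f : T1 * T2 -> R.
Hypothesis intf : (m1 \x m2)%E.-integrable setT (EFin \o f).

(** The inner real integral is the [fine] of the extended one; the two agree wherever the section of
    [f] is integrable, hence almost everywhere. *)
Lemma Rintegral12_prod_meas :
  \int[m1]_x \int[m2]_y f (x, y) = \int[(m1 \x m2)%E]_z f z.
Proof.
rewrite /Rintegral -integral12_prod_meas1//; congr fine.
have mF := measurable_fubini_F intf.
apply: ae_eq_integral => //.
  exact/measurable_EFinP/(measurableT_comp (@fine_measurable _ setT _)).
have := ae_integrable1 intf; apply: filterS => x xf _ /=.
by rewrite /fubini_F fineK//; exact: integrable_fin_num.
Qed.

Lemma Rintegral21_prod_meas :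
  \int[m2]_y \int[m1]_x f (x, y) = \int[(m1 \x m2)%E]_z f z.
Proof.
rewrite /Rintegral -integral21_prod_meas1//; congr fine.
have mG := measurable_fubini_G intf.
apply: ae_eq_integral => //.
  exact/measurable_EFinP/(measurableT_comp (@fine_measurable _ setT _)).
have := ae_integrable2 intf; apply: filterS => y yf _ /=.
by rewrite /fubini_G fineK//; exact: integrable_fin_num.
Qed.

End RealFubini.

(* The library registers [m1 \x m2] as sigma-finite only for subprobabilities,
   hence this alias. *)
Section SigmaFiniteProduct.
Context d1 d2 (T1 : measurableType d1) (T2 : measurableType d2) (R : realType).
Variable m1 : {sigma_finite_measure set T1 -> \bar R}.
Variable m2 : {sigma_finite_measure set T2 -> \bar R}.

Definition sprod : set (T1 * T2) -> \bar R := (m1 \x m2)%E.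

HB.instance Definition _ := Measure.on sprod.

Lemma sigma_finite_sprod : sigma_finite setT sprod.
Proof.
have /sigma_finiteP[F [TF ndF Foo]] := sigma_finiteT m1.
have /sigma_finiteP[G [TG ndG Goo]] := sigma_finiteT m2.
exists (fun n => F n `*` G n).
  apply/esym/seteqP; split=> // -[x y] _.
  have : setT x by []. rewrite TF => -[n _ Fnx].
  have : setT y by []. rewrite TG => -[k _ Gky].
  exists (maxn n k) => //; split => /=.
    by move: x Fnx; exact/subsetPset/ndF/leq_maxl.
  by move: y Gky; exact/subsetPset/ndG/leq_maxr.
move=> k; have [? ?] := Foo k; have [? ?] := Goo k.
split; first exact: measurableX.
by rewrite /sprod product_measure1E// lte_mul_pinfty// ge0_fin_numE.
Qed.

HB.instance Definition _ := Measure_isSigmaFinite.Build _ _ _ sprod sigma_finite_sprod.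

End SigmaFiniteProduct.

Section TripleFubini.
Context d1 d2 d3 (T1 : measurableType d1) (T2 : measurableType d2)
  (T3 : measurableType d3) (R : realType).
Variable m1 : {sigma_finite_measure set T1 -> \bar R}.
Variable m2 : {sigma_finite_measure set T2 -> \bar R}.
Variable m3 : {sigma_finite_measure set T3 -> \bar R}.
Variable f : (T2 * T3) * T1 -> R.

(** Carries the vanishing of the final value through an interchange of integrals: [x] is the
    variable of that value, [y] and [z] are integrated to form it. Vanishing is asked only where the
    section in [(y, z)] is integrable, since only there can an iterated integral be read as a double
    one; Fubini provides such sections for almost every [x]. *)
Lemma triple_Rintegral_eq0 : measurable_fun setT f ->
  (\int[m3]_z \int[m2]_y \int[m1]_x `|f ((y, z), x)|%:E < +oo)%E ->
  {ae m1, forall x,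
    (m2 \x m3)%E.-integrable setT (EFin \o (fun yz => f (yz, x))) ->
    \int[(m2 \x m3)%E]_z f (z, x) = 0} ->
  \int[m3]_z \int[m2]_y \int[m1]_x f ((y, z), x) = 0.
Proof.
move=> mf foo f0.
have intf : (sprod m2 m3 \x m1)%E.-integrable setT (EFin \o f).
  apply: (integrable12ltyP _ _ _).2; first exact/measurable_EFinP.
  rewrite [X in (X < _)%E](_ : _ =
    \int[(m2 \x m3)%E]_z \int[m1]_x `|f (z, x)|%:E)%E//.
  rewrite fubini_tonelli2//=.
    apply: (@measurable_fun_fubini_tonelli_F _ _ _ _ _ m1
      (fun z => `|(f z)%:E|)%E) => //.
    by apply/measurable_EFinP; exact: measurableT_comp.
  by move=> z; exact: integral_ge0.
(* [fine] sends infinities to 0, so the real inner integral is dominated by the Fubini function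
   everywhere, with no null set to discard. *)
have fine_le (e : \bar R) : (`|(fine e)%:E| <= `|e|)%E.
  by case: e => [r||] /=; rewrite ?normr0 ?leey ?lexx.
pose g yz := \int[m1]_x f (yz, x).
have intg : (m2 \x m3)%E.-integrable setT (EFin \o g).
  have := integrable_fubini_F intf.
  apply: (le_integrable measurableT) => [|yz _].
    apply/measurable_EFinP.
    apply: (measurableT_comp (@fine_measurable _ setT _)) => //.
    exact: measurable_fubini_F intf.
  rewrite /= /g /Rintegral /fubini_F; exact: fine_le.
rewrite -[LHS]/(\int[m3]_z \int[m2]_y g (y, z)).
rewrite (Rintegral21_prod_meas intg).
rewrite -[LHS]/(\int[sprod m2 m3]_z \int[m1]_x f (z, x)).
rewrite (Rintegral12_prod_meas intf) -(Rintegral21_prod_meas intf).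
rewrite /Rintegral (ae_eq_integral (cst 0%E)) ?integral0//.
  apply/measurable_EFinP/(measurableT_comp (@fine_measurable _ setT _)) => //.
  exact: measurable_fubini_G intf.
have := ae_integrable2 intf; move: f0; apply: filterS2 => x fx0 intx _ /=.
by congr EFin; exact: fx0.
Qed.

End TripleFubini.

(** * Uniqueness for superexponentially small Laplace transforms *)

Section RealDominated.
Context d (T : measurableType d) (R : realType).
Variable m : {measure set T -> \bar R}.

Lemma Rdominated_convergence (F : nat -> T -> R) (f h : T -> R) :
  (forall n, measurable_fun setT (F n)) -> measurable_fun setT f ->
  {ae m, forall x, F ^~ x @ \oo --> f x} ->
  m.-integrable setT (EFin \o h) -> (forall n x, `|F n x| <= h x) ->
  \int[m]_x F n x @[n --> \oo] --> \int[m]_x f x.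
Proof.
move=> mF mf Ff ih Fh.
have [|||||] := @dominated_convergence _ _ R m setT measurableT
  (fun n => EFin \o F n) (EFin \o f) (EFin \o h).
- by move=> n; exact/measurable_EFinP.
- exact/measurable_EFinP.
- move: Ff; apply: filterS => x Fx _; apply: cvg_EFin => //.
  exact: nearW.
- exact: ih.
- by apply: aeW => x n _; rewrite /= lee_fin.
move=> iF _ cF; apply: fine_cvg.
by rewrite /Rintegral fineK//; exact: integrable_fin_num.
Qed.

End RealDominated.

Section AlternatingExp.
Context {R : realType}.
Implicit Types v : R.

Definition altexp_coef n : R := (-1) ^+ n / n.+1`!%:R.

(** Partial sums of [1 - expR (- v)]. At [v = expR (k * (t - u))] each power is a multiple of an
    exponential in [u], so integrating against [g] only samples its transform at the multiples of
    [k]. *)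
Definition altexp (N : nat) v : R := \sum_(n < N) altexp_coef n * v ^+ n.+1.

Lemma normr_altexp_coef n : `|altexp_coef n| = n.+1`!%:R^-1.
Proof. by rewrite normrM normrX normrN1 expr1n mul1r ger0_norm// invr_ge0. Qed.

(** The factor [v] kept in front serves twice: it makes the error bound tend to 0 with [w k], and it
    retains the integrable weight when dominating the partial sums. *)
Lemma sum_altexp_le N v : 0 <= v ->
  \sum_(n < N) n.+1`!%:R^-1 * v ^+ n.+1 <= v * expR v.
Proof.
move=> v0; apply: (@le_trans _ _ (v * series (exp_coeff v) N)); last first.
  rewrite ler_wpM2l//; apply: nondecreasing_cvgn_le; last exact: is_cvg_series_exp_coeff.
  apply/nondecreasing_seqP => n; rewrite -subr_ge0 seriesSB.
  exact: exp_coeff_ge0.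
rewrite /series/= big_mkord mulr_sumr; apply: ler_sum => n _.
rewrite exp_coeffE exprS mulrCA ler_wpM2l// ler_wpM2r ?exprn_ge0//.
by rewrite lef_pV2 ?posrE ?ltr0n ?fact_gt0// ler_nat factS leq_pmull.
Qed.

Lemma altexp_cvg v : altexp N v @[N --> \oo] --> 1 - expR (- v).
Proof.
have E N : altexp N v = 1 - series (exp_coeff (- v)) N.+1.
  rewrite /series/= big_mkord big_ord_recl/= exp_coeffE/= fact0 expr0 invr1 mul1r.
  rewrite opprD addrA subrr sub0r -sumrN; apply: eq_bigr => n _.
  rewrite /altexp_coef /bump/= add1n [(- v) ^+ _]exprNn [(-1) ^+ n.+1]exprS; ring.
under eq_fun do rewrite E.
apply: cvgB; first exact: cvg_cst.
rewrite (cvg_shiftS (series (exp_coeff (- v)))).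
exact: is_cvg_series_exp_coeff.
Qed.

End AlternatingExp.

(* Phragmen's inversion: [sum_n (-1)^n/(n+1)! e^((n+1)k(t-u))] tends to the indicator
   of [u < t] as [k] grows. *)
Section Lerch.
Context d (T : measurableType d) (R : realType).
Variable m : {measure set T -> \bar R}.
Variables (g th : T -> R) (A p0 b c C t : R).
Hypotheses (mg : measurable_fun setT g) (mth : measurable_fun setT th).
Hypotheses (p0_gt0 : 0 < p0) (c_gt0 : 0 < c).
Hypothesis th_ge0 : forall x, g x != 0 -> 0 <= th x.
Hypothesis intg : forall p, p0 <= p ->
  m.-integrable setT (EFin \o (fun x => g x * expR (- (p * th x)))).
Hypothesis small : forall p, p0 <= p ->
  `|A + \int[m]_x (g x * expR (- (p * th x)))| <= C * expR (b * p - c * p ^+ 2).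
Hypotheses (t_gt0 : 0 < t) (null_t : m [set x | th x = t] = 0%E).

Let I p := \int[m]_x (g x * expR (- (p * th x))).
Let v (k : R) x := expR (k * (t - th x)).
Let w k := expR (k * (t + b - c * k)).

Let C_ge0 : 0 <= C.
Proof.
have := le_trans (normr_ge0 _) (small (lexx p0)).
by rewrite pmulr_lge0// expR_gt0.
Qed.

Let mv k : measurable_fun setT (v k).
Proof.
apply: measurableT_comp => //; apply: measurable_funM => //.
exact: measurable_funB.
Qed.

Let vX k n x :
  v k x ^+ n.+1 = expR (n.+1%:R * k * t) * expR (- (n.+1%:R * k * th x)).
Proof. by rewrite /v -expRM_natl -expRD; congr expR; ring. Qed.

Let le_p0 k n : p0 <= k -> p0 <= n.+1%:R * k.
Proof.
move=> p0k; rewrite (le_trans p0k)// ler_peMl ?ler1n//.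
by rewrite ltW// (lt_le_trans p0_gt0).
Qed.

Let altexp_integral k N : p0 <= k ->
  m.-integrable setT (EFin \o (fun x => g x * altexp N (v k x))) /\
  \int[m]_x (g x * altexp N (v k x)) =
  \sum_(n < N) altexp_coef n * expR (n.+1%:R * k * t) * I (n.+1%:R * k).
Proof.
move=> p0k; elim: N => [|N [intN EN]].
  rewrite big_ord0 /altexp; split.
    apply: (eq_integrable _ (cst 0%E)) => // [x _|]; first by rewrite /= big_ord0 mulr0.
    exact: integrable0.
  by rewrite /Rintegral integral0_eq// => x _; rewrite big_ord0 mulr0.
have i1 : m.-integrable setT (EFin \o (fun x =>
    (altexp_coef N * expR (N.+1%:R * k * t)) *
    (g x * expR (- (N.+1%:R * k * th x))))).
  apply: (eq_integrable _ (fun x => ((altexp_coef N * expR (N.+1%:R * k * t))%:E *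
    (g x * expR (- (N.+1%:R * k * th x)))%:E)%E)) => //.
  by apply: integrableZl => //; apply: intg; exact: le_p0.
have E x : g x * altexp N.+1 (v k x) = g x * altexp N (v k x) +
    (altexp_coef N * expR (N.+1%:R * k * t)) *
    (g x * expR (- (N.+1%:R * k * th x))).
  by rewrite {1}/altexp big_ord_recr/= -/(altexp N _) vX; ring.
split.
  apply: (eq_integrable _ (fun x => ((g x * altexp N (v k x))%:E +
    ((altexp_coef N * expR (N.+1%:R * k * t)) *
    (g x * expR (- (N.+1%:R * k * th x))))%:E)%E)) => //.
    by move=> x _; rewrite /= E EFinD.
  exact: integrableD.
under eq_Rintegral do rewrite E.
rewrite RintegralD// big_ord_recr/= -EN RintegralZl//.
by apply: intg; exact: le_p0.
Qed.

(** Uniform in [N]: the growth of the coefficient at the sample point [n.+1 * k] meets a decay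
    quadratic in that point, and [n.+1 ^ 2 >= n.+1] bounds the product by [w k ^+ n.+1]. What
    remains is an exponential series at [w k]. *)
Let altexp_bound k N : p0 <= k ->
  `|A * altexp N (expR (k * t)) + \int[m]_x (g x * altexp N (v k x))|
  <= C * (w k * expR (w k)).
Proof.
move=> p0k; have [_ ->] := altexp_integral N p0k.
rewrite /altexp mulr_sumr -big_split/=.
apply: (@le_trans _ _ (\sum_(n < N) C * (n.+1`!%:R^-1 * w k ^+ n.+1))); last first.
  by rewrite -mulr_sumr ler_wpM2l// sum_altexp_le// expR_ge0.
apply: (le_trans (ler_norm_sum _ _ _)); apply: ler_sum => n _.
rewrite -expRM_natl mulrA [A * _]mulrC -[X in `|X + _|]mulrA.
rewrite (_ : _ + _ = altexp_coef n * expR (n.+1%:R * k * t) * (A + I (n.+1%:R * k))); last first.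
  by rewrite [n.+1%:R * (k * t)]mulrA; ring.
rewrite normrM [X in X * _ <= _]normrM normr_altexp_coef (ger0_norm (expR_ge0 _)).
have n1 : 1 <= n.+1%:R :> R by rewrite ler1n.
have k0 : 0 < k := lt_le_trans p0_gt0 p0k.
rewrite -[leLHS]mulrA [leRHS]mulrCA ler_wpM2l ?invr_ge0//.
apply: (@le_trans _ _ (expR (n.+1%:R * k * t) *
  (C * expR (b * (n.+1%:R * k) - c * (n.+1%:R * k) ^+ 2)))).
  by rewrite ler_wpM2l ?expR_ge0//; apply: small; exact: le_p0.
rewrite mulrCA ler_wpM2l// -expRD /w -expRM_natl ler_expR.
rewrite -subr_ge0 (_ : _ - _ = c * k ^+ 2 * n.+1%:R * (n.+1%:R - 1)); last by ring.
by rewrite mulr_ge0 ?subr_ge0// mulr_ge0// mulr_ge0 ?exprn_ge0 ?(ltW c_gt0) ?(ltW k0).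
Qed.

Let chi_bound k : p0 <= k ->
  `|A * (1 - expR (- expR (k * t))) + \int[m]_x (g x * (1 - expR (- v k x)))|
  <= C * (w k * expR (w k)).
Proof.
move=> p0k; have k0 : 0 < k := lt_le_trans p0_gt0 p0k.
have L : A * altexp N (expR (k * t)) + \int[m]_x (g x * altexp N (v k x))
    @[N --> \oo] -->
  A * (1 - expR (- expR (k * t))) + \int[m]_x (g x * (1 - expR (- v k x))).
  apply: cvgD; first by apply: cvgM; [exact: cvg_cst|exact: altexp_cvg].
  (* Since [th >= 0] wherever [g] is nonzero, [v k x <= expR (k * t)] there. In [v * expR v] only
     the outer [v] keeps its dependence on [th], which supplies integrability. *)
  pose M := expR (k * t) * expR (expR (k * t)).
  apply: (@Rdominated_convergence _ _ _ m _ _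
      (fun x => M * `|g x * expR (- (k * th x))|)).
  - move=> n; have [/integrableP[/measurable_EFinP//]] := altexp_integral n p0k.
  - apply: measurable_funM => //; apply: measurable_funB => //.
    by apply: measurableT_comp => //; exact: measurableT_comp.
  - apply: aeW => x; apply: cvgM; [exact: cvg_cst|exact: altexp_cvg].
  - have /integrable_norm := intg p0k; move=> /(integrableZl measurableT M).
    by apply: eq_integrable.
  - move=> N x; have [->|gx] := eqVneq (g x) 0.
      by rewrite !mul0r normr0 mulr0.
    have thx := th_ge0 gx; rewrite !normrM mulrCA ler_wpM2l//.
    apply: (@le_trans _ _ (v k x * expR (v k x))).
      apply: (le_trans _ (sum_altexp_le N (expR_ge0 _))).
      apply: (le_trans (ler_norm_sum _ _ _)); apply: ler_sum => n _.
      by rewrite normrM normr_altexp_coef ger0_norm// exprn_ge0// expR_ge0.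
    have E : v k x = expR (k * t) * expR (- (k * th x)).
      by rewrite /v -expRD; congr expR; ring.
    rewrite (ger0_norm (expR_ge0 _)) {1}E /M mulrAC ler_wpM2r ?expR_ge0//.
    rewrite ler_wpM2l ?expR_ge0// ler_expR ler_expR.
    by rewrite ler_pM2l// gerDl oppr_le0.
apply: (ler_cvg_to (cvg_norm L) (cvg_cst _)).
by apply: nearW => N; exact: altexp_bound.
Qed.

Let k_ n : R := p0 + n%:R.

Let k_ge n : p0 <= k_ n. Proof. by rewrite lerDl. Qed.

Let k_gt0 n : 0 < k_ n. Proof. exact: lt_le_trans (k_ge n). Qed.

Let cvg_k : k_ n @[n --> \oo] --> +oo.
Proof.
apply/cvgryPge => M; near=> n.
rewrite (@le_trans _ _ n%:R) ?lerDr ?(ltW p0_gt0)//; near: n; exact: nbhs_infty_ger.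
Unshelve. all: by end_near. Qed.

Let cvg_expRN (u : nat -> R) : u n @[n --> \oo] --> +oo ->
  expR (- u n) @[n --> \oo] --> 0.
Proof. by move=> uy; apply: (cvg_comp u (fun x => expR (- x))) uy (@cvgr_expR R). Qed.

Let cvg_w : C * (w (k_ n) * expR (w (k_ n))) @[n --> \oo] --> 0.
Proof.
have w0 : w (k_ n) @[n --> \oo] --> 0.
  rewrite (_ : (fun n => w (k_ n)) = (fun n => expR (- (k_ n * (c * k_ n - t - b))))); last first.
    by apply/funext => n; rewrite /w; congr expR; ring.
  apply: cvg_expRN; apply/cvgryPge => M.
  have /cvgryPge ky := cvg_k.
  (* From [k >= (1 + t + b) / c] on, [c * k - t - b] is at least 1 and the exponent is at least [k];
     this is available for every [t]. *)
  have := ky M; have := ky ((1 + t + b) / c); apply: filterS2 => n.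
  rewrite ler_pdivrMr// [_ * c]mulrC => H /le_trans; apply.
  by rewrite ler_peMr ?(ltW (k_gt0 n))//; lra.
rewrite -[X in _ --> X](mulr0 C); apply: cvgM; first exact: cvg_cst.
rewrite -[X in _ --> X](mul0r (expR 0)); apply: cvgM => //.
by apply: continuous_cvg => //; exact: continuous_expR.
Qed.

Let cvg_chi1 (s : R) : 0 < s ->
  1 - expR (- expR (k_ n * s)) @[n --> \oo] --> (1 : R).
Proof.
move=> s0; rewrite -[X in _ --> X]subr0; apply: cvgB; first exact: cvg_cst.
apply: cvg_expRN; apply/cvgryPge => M; have /cvgryPge := cvg_k.
move=> /(_ (M / s)); apply: filterS => n; rewrite ler_pdivrMr// => /le_trans; apply.
by rewrite (le_trans _ (expR_ge1Dx _))// lerDr.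
Qed.

Let cvg_chi0 (s : R) : s < 0 ->
  1 - expR (- expR (k_ n * s)) @[n --> \oo] --> (0 : R).
Proof.
move=> s0; rewrite -[X in _ --> X](subrr 1) -[X in _ --> _ - X]expR0.
apply: cvgB; first exact: cvg_cst.
apply: continuous_cvg; first exact: continuous_expR.
rewrite -[X in _ --> X]oppr0; apply: cvgN.
rewrite (_ : (fun n => _) = (fun n => expR (- (k_ n * - s)))); last first.
  by apply/funext => n; congr expR; ring.
apply: cvg_expRN; apply/cvgryPge => M; have /cvgryPge := cvg_k.
by move=> /(_ (M / - s)); apply: filterS => n; rewrite ler_pdivrMr ?oppr_gt0.
Qed.

(** [A] acts as a point mass at [th = 0], and [th] encodes a change of variable without moving the
    measure. Where [th x = t] the smoothed indicator tends to [1 - expR (-1)] instead of 0 or 1,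
    hence the hypothesis [null_t]. *)
Lemma lerch : A + \int[m]_(x in [set x | th x <= t]) g x = 0.
Proof.
have L : A * (1 - expR (- expR (k_ n * t))) +
    \int[m]_x (g x * (1 - expR (- v (k_ n) x))) @[n --> \oo] -->
    A + \int[m]_(x in [set x | th x <= t]) g x.
  apply: cvgD.
    by rewrite -[X in _ --> X]mulr1; apply: cvgM; [exact: cvg_cst|exact: cvg_chi1].
  rewrite Rintegral_mkcond.
  have mS : measurable [set x | th x <= t].
    rewrite [X in measurable X](_ : _ = th @^-1` `]-oo, t]); last first.
      by apply/seteqP; split => x /=; rewrite in_itv.
    by rewrite -[X in measurable X]setTI; exact: mth.
  apply: (@Rdominated_convergence _ _ _ m _ _
      (fun x => expR (p0 * t) * `|g x * expR (- (p0 * th x))|)).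
  - move=> n; apply: measurable_funM => //; apply: measurable_funB => //.
    by apply: measurableT_comp => //; exact: measurableT_comp.
  - by apply/(measurable_restrictT _ _).1 => //; exact: measurable_funTS.
  - exists [set x | th x = t]; split=> //.
      rewrite [X in measurable X](_ : _ = th @^-1` [set t])//.
      by rewrite -[X in measurable X]setTI; exact: mth.
    move=> x /=; apply: contra_notP => /eqP tx.
    rewrite patchE; case: ifPn.
      rewrite inE/= le_eqVlt (negbTE tx)/= => xt.
      rewrite -[X in _ --> X]mulr1; apply: cvgM; first exact: cvg_cst.
      by apply: cvg_chi1; rewrite subr_gt0.
    rewrite notin_setE/= => /negP; rewrite -ltNge => xt.
    rewrite -[X in _ --> X](mulr0 (g x)); apply: cvgM; first exact: cvg_cst.
    by apply: cvg_chi0; rewrite subr_lt0.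
  - have /integrable_norm := intg (lexx p0); move=> /(integrableZl measurableT (expR (p0 * t))).
    by apply: eq_integrable.
  (* The weight at [k = p0] dominates: for [th x <= t] it is at least 1, and for [th x > t] one has
     [1 - expR (- v) <= v] with [v] decreasing in [k]. *)
  - move=> n x; rewrite !normrM mulrCA ler_wpM2l// (ger0_norm (expR_ge0 _)) -expRD.
    rewrite -mulrBr.
    have e1 : expR (- v (k_ n) x) <= 1 by rewrite -expR0 ler_expR oppr_le0 expR_ge0.
    rewrite ger0_norm ?subr_ge0//; have [xt|xt] := leP (th x) t.
      apply: (@le_trans _ _ 1); first by rewrite gerDl oppr_le0 expR_ge0.
      by rewrite -expR0 ler_expR mulr_ge0 ?subr_ge0// ltW.
    apply: (@le_trans _ _ (v (k_ n) x)).
      by have := expR_ge1Dx (- v (k_ n) x); lra.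
    rewrite ler_expR -subr_ge0 -mulrBl mulr_le0// ?subr_le0// ltW//.
apply: (cvg_unique _ L) => //.
apply/norm_cvg0P; apply: (squeeze_cvgr _ (cvg_cst 0) cvg_w).
by apply: nearW => n; rewrite normr_ge0/= chi_bound.
Qed.

End Lerch.

(** * The heat kernel and the weight [wa] *)

Lemma integral_mulb d (T : measurableType d) (R : realType)
    (m : {measure set T -> \bar R}) (f : T -> R) (P : T -> bool) :
  (\int[m]_x (f x * (P x)%:R)%:E = \int[m]_(x in [set x | P x]) (f x)%:E)%E.
Proof.
rewrite [RHS]integral_mkcond; apply: eq_integral => x _.
rewrite patchE; case: ifPn; rewrite ?inE/= ?notin_setE/=.
  by move=> ->; rewrite mulr1.
by move=> /negP/negbTE ->; rewrite mulr0.
Qed.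

Section HeatKernel.
Context {R : realType}.
Notation mu := (@lebesgue_measure R).
Implicit Types a m t u x y z : R.

Lemma Ka_ge0 a t u : 0 <= Ka a t u.
Proof. by rewrite mulr_ge0 ?invr_ge0 ?sqrtr_ge0 ?expR_ge0. Qed.

(** The square root of a nonpositive number is 0, and so is the inverse of 0. Kernel and weight thus
    vanish at nonpositive times, which lets time integrals run over the whole line. *)
Lemma Ka_le0 a t u : t <= 0 -> Ka a t u = 0.
Proof.
move=> t0; rewrite /Ka ler0_sqrtr ?invr0 ?mul0r//.
by rewrite mulr_ge0_le0// mulr_ge0// pi_ge0.
Qed.

(** The exponential test functions only change the drift parameter, so testing the kernel reduces to
    the total mass of [Ka m]. *)
Lemma Ka_shift a m t u : Ka a t u * expR ((m - a) * u) = Ka m t u.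
Proof.
by rewrite /Ka -[LHS]mulrA -expRD; congr (_ * expR _); ring.
Qed.

(** Completing the square: mean [2 * m * t], variance [2 * t], and total mass
    [expR (m ^+ 2 * t)]. *)
Lemma KaE m t u : 0 < t ->
  Ka m t u = expR (m ^+ 2 * t) * normal_pdf (2 * m * t) (Num.sqrt (2 * t)) u.
Proof.
move=> t0; have t20 : 0 < 2 * t by rewrite mulr_gt0.
rewrite normal_pdfE ?gt_eqF ?sqrtr_gt0// /normal_peak /normal_fun.
rewrite sqr_sqrtr ?ltW// mulrCA -[X in _ = _ * X]expRD /Ka; congr (_^-1 * expR _).
  by congr Num.sqrt; rewrite -mulr_natl; ring.
by field; rewrite gt_eqF.
Qed.

(** Real powers are measurable in their base, so this form gives joint measurability in time and
    space. *)
Lemma KaE_powR a t u : 0 < t -> Ka a t u =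
  (4 * pi * t) `^ (- 2^-1) * expR (- (u ^+ 2) * (4 * t) `^ (-1) + a * u).
Proof.
move=> t0; rewrite powRN powR12_sqrt; last by rewrite !mulr_ge0 ?pi_ge0// ltW.
by rewrite powR_inv1// mulr_ge0// ltW.
Qed.

Lemma measurable_Ka a : measurable_fun setT (fun z : R * R => Ka a z.1 z.2).
Proof.
rewrite (_ : (fun z : R * R => _) = fun z : R * R => if 0 < z.1 then
  (4 * pi * z.1) `^ (- 2^-1) * expR (- (z.2 ^+ 2) * (4 * z.1) `^ (-1) + a * z.2)
  else 0); last first.
  by apply/funext => z; case: ltP => [/KaE_powR->|/Ka_le0->].
apply: measurable_fun_ifT => //.
  exact: measurable_fun_ltr.
apply: measurable_funM.
  apply: (measurableT_comp (measurable_powR _)).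
  exact: measurable_funM.
apply: measurableT_comp => //; apply: measurable_funD.
  apply: measurable_funM.
    by apply: measurableT_comp => //; exact: measurable_funX.
  apply: (measurableT_comp (measurable_powR _)).
  exact: measurable_funM.
exact: measurable_funM.
Qed.

Lemma integral_Ka_translate a m t x : 0 < t ->
  (\int[mu]_y (Ka a t (y - x) * expR ((m - a) * y))%:E =
   (expR (m ^+ 2 * t) * expR ((m - a) * x))%:E)%E.
Proof.
move=> t0; pose s := Num.sqrt (2 * t).
have s0 : s != 0 by rewrite gt_eqF// sqrtr_gt0 mulr_gt0.
under eq_integral => y _.
  rewrite (_ : _ * _ = expR (m ^+ 2 * t) * expR ((m - a) * x) *
      normal_pdf (2 * m * t + x) s y).
    rewrite EFinM; over.
  rewrite [in LHS](_ : expR ((m - a) * y) =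
      expR ((m - a) * (y - x)) * expR ((m - a) * x)); last first.
    by rewrite -expRD; congr expR; ring.
  rewrite mulrA Ka_shift KaE// mulrAC; congr (_ * _ * _).
  rewrite /normal_pdf (negbTE s0); congr (_ * _).
  by rewrite /normal_fun opprD addrA addrAC.
rewrite integralZl//; last exact: integrable_normal_pdf.
by rewrite integral_normal_pdf mule1.
Qed.

Lemma integral_Ka_reflect a t x : 0 < t ->
  (\int[mu]_z (Ka a t (x - z))%:E = (expR (a ^+ 2 * t))%:E)%E.
Proof.
move=> t0; pose s := Num.sqrt (2 * t).
have s0 : s != 0 by rewrite gt_eqF// sqrtr_gt0 mulr_gt0.
under eq_integral => y _.
  rewrite (_ : Ka a t _ = expR (a ^+ 2 * t) * normal_pdf (x - 2 * a * t) s y).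
    rewrite EFinM; over.
  rewrite KaE//; congr (_ * _).
  rewrite /normal_pdf (negbTE s0); congr (_ * _).
  rewrite /normal_fun (_ : y - (x - 2 * a * t) = - (x - y - 2 * a * t)) ?sqrrN//.
  by ring.
rewrite integralZl//; last exact: integrable_normal_pdf.
by rewrite integral_normal_pdf mule1.
Qed.

Lemma measurable_Ka_comp d (T : measurableType d) a (t u : T -> R) :
  measurable_fun setT t -> measurable_fun setT u ->
  measurable_fun setT (fun w => Ka a (t w) (u w)).
Proof.
move=> mt mu'; apply: (measurableT_comp (measurable_Ka a)
  (g := fun w => (t w, u w))).
exact: measurable_fun_pair.
Qed.

(** The integral is finite, so the [fine] hidden in [wa] loses nothing; the indicator form is the
    one to which Tonelli on the full line applies. *)
Lemma waE a t x :
  ((wa a t x)%:E = \int[mu]_z (Ka a t (x - z) * (0 <= z)%R%:R)%:E)%E.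
Proof.
rewrite integral_mulb (_ : [set z | 0 <= z] = `[0, +oo[%classic); last first.
  by apply/seteqP; split => z /=; rewrite in_itv/= andbT.
rewrite /wa /Rintegral fineK// fin_numElt.
apply/andP; split.
  by rewrite (lt_le_trans ltNy0)// integral_ge0// => z _; rewrite lee_fin Ka_ge0.
have [t0|t0] := ltP 0 t; last first.
  rewrite integral0_eq ?ltry// => z _; by rewrite Ka_le0.
apply: (@le_lt_trans _ _ (\int[mu]_z (Ka a t (x - z))%:E)%E).
  apply: ge0_subset_integral => //.
    by apply/measurable_EFinP; apply: measurable_Ka_comp => //; exact: measurable_funB.
  by move=> z _; rewrite lee_fin Ka_ge0.
by rewrite integral_Ka_reflect// ltry.
Qed.

Lemma wa_ge0 a t x : 0 <= wa a t x.
Proof. by apply: Rintegral_ge0 => z _; exact: Ka_ge0. Qed.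

Lemma wa_le0 a t x : t <= 0 -> wa a t x = 0.
Proof.
move=> t0; rewrite /wa /Rintegral integral0_eq// => z _; by rewrite Ka_le0.
Qed.

(** The half-line mass is at most the total mass. The growth rate [a ^+ 2] is the source of the
    threshold |a| < p in the time transforms. *)
Lemma wa_le a t x : wa a t x <= expR (a ^+ 2 * t).
Proof.
have [t0|t0] := ltP 0 t; last by rewrite wa_le0// expR_ge0.
rewrite -lee_fin waE -(integral_Ka_reflect a x t0).
apply: ge0_le_integral => //.
- by move=> z _; rewrite lee_fin mulr_ge0// Ka_ge0.
- apply/measurable_EFinP; apply: measurable_funM.
    by apply: measurable_Ka_comp => //; exact: measurable_funB.
  apply: (measurableT_comp (f := fun b : bool => b%:R : R)) => //.
  exact: measurable_fun_ler.
- by apply/measurable_EFinP; apply: measurable_Ka_comp => //; exact: measurable_funB.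
- by move=> z _; rewrite lee_fin ler_piMr ?Ka_ge0// lern1 leq_b1.
Qed.

Lemma measurable_wa a : measurable_fun setT (fun z : R * R => wa a z.1 z.2).
Proof.
apply/measurable_EFinP => /=.
under [X in measurable_fun _ X]eq_fun do rewrite waE.
pose f (w : (R * R) * R) :=
  (Ka a w.1.1 (w.1.2 - w.2) * (0 <= w.2)%R%:R)%:E.
apply: (@measurable_fun_fubini_tonelli_F _ _ _ _ _ mu f) => [|w]; last first.
  by rewrite /f lee_fin mulr_ge0// Ka_ge0.
apply/measurable_EFinP; apply: measurable_funM.
  apply: measurable_Ka_comp; first exact: measurableT_comp.
  by apply: measurable_funB => //; exact: measurableT_comp.
apply: (measurableT_comp (f := fun b : bool => b%:R : R)) => //.
exact: measurable_fun_ler.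
Qed.

End HeatKernel.

(** * Laplace transforms in time *)

Section GaussCdf.
Context {R : realType}.
Notation mu := (@lebesgue_measure R).
Implicit Types x : R.

(** With this standard deviation the centred density is [expR (- x ^+ 2) / Num.sqrt pi], so [gcdf]
    is (1 + erf) / 2. *)
Let s := Num.sqrt (2^-1 : R).

Let s0 : s != 0. Proof. by rewrite gt_eqF// sqrtr_gt0 invr_gt0. Qed.

Definition gcdf x := \int[mu]_(t in `]-oo, x]) normal_pdf 0 s t.

Lemma gauss_pdfE x : normal_pdf 0 s x = (Num.sqrt pi)^-1 * expR (- x ^+ 2).
Proof.
rewrite normal_pdfE// /normal_peak /normal_fun subr0 sqr_sqrtr ?invr_ge0//.
congr ((Num.sqrt _)^-1 * expR _).
  by rewrite -mulr_natr mulrAC mulVf ?mul1r.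
by rewrite -[_ *+ 2]mulr_natr mulVf ?divr1.
Qed.

Lemma is_derive_gcdf x :
  is_derive x 1 gcdf ((Num.sqrt pi)^-1 * expR (- x ^+ 2)).
Proof.
have [] := @continuous_FTC1 R (normal_pdf 0 s) -oo%O x (x + 1).
- by rewrite ltrDl.
- by apply: integrableS (integrable_normal_pdf 0 s).
- exact: ltNyr.
- exact: continuous_normal_pdf.
by move=> dN N'; apply: DeriveDef => //; rewrite -derive1E N' gauss_pdfE.
Qed.

Let P : probability _ R := normal_prob 0 s.

Let X : measurableTypeR R -> R := idfun.

#[local] HB.instance Definition _ :=
  @isMeasurableFun.Build _ _ _ _ X (@measurable_id _ _ setT).

Let gcdfE x : (gcdf x)%:E = cdf (X : {RV P >-> R}) x.
Proof.
rewrite /gcdf /Rintegral fineK//.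
apply: integrable_fin_num => //.
by apply: integrableS (integrable_normal_pdf 0 s).
Qed.

Lemma gcdf_cvgy : gcdf x @[x --> +oo] --> (1 : R).
Proof.
have := cvg_cdfy1 (X : {RV P >-> R}).
rewrite (_ : cdf _ = EFin \o gcdf); last by apply/funext => x /=; rewrite gcdfE.
by move/fine_cvgP => [].
Qed.

Lemma gcdf_cvgNy : gcdf x @[x --> -oo] --> (0 : R).
Proof.
have := cvg_cdfNy0 (X : {RV P >-> R}).
rewrite (_ : cdf _ = EFin \o gcdf); last by apply/funext => x /=; rewrite gcdfE.
by move/fine_cvgP => [].
Qed.

End GaussCdf.

(** * Laplace transform in time of the driftless heat kernel *)

Section LaplaceHeat.
Context {R : realType}.
Notation mu := (@lebesgue_measure R).
Variables p q : R.
Hypotheses (p0 : 0 < p) (q0 : 0 < q).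

Let A (s : R) := p * Num.sqrt s + q / 2 * (Num.sqrt s)^-1.
Let B (s : R) := p * Num.sqrt s - q / 2 * (Num.sqrt s)^-1.
(** The error-function antiderivative of [f]. Both [A ^+ 2 - p * q] and [B ^+ 2 + p * q] equal
    [p ^+ 2 * s + q ^+ 2 / (4 * s)], so the two Gaussian factors of the derivative coincide and the
    [q] parts of the derivatives of [A] and [B] cancel. *)
Let F (s : R) := expR (p * q) * gcdf (A s) + expR (- (p * q)) * gcdf (B s).
Let f (s : R) := 2 * p * (expR (- (p ^+ 2 * s)) * Ka 0 s q).

Let F' (s : R) : 0 < s -> is_derive s 1 F (f s).
Proof.
move=> s0; have r0 : 0 < Num.sqrt s by rewrite sqrtr_gt0.
have dr := is_derive1_sqrt s0.
have dV := is_deriveV (lt0r_neq0 r0) dr.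
have dA : is_derive s 1 A (p * (2 * Num.sqrt s)^-1 +
    q / 2 * (- (Num.sqrt s) ^- 2 *: (2 * Num.sqrt s)^-1)).
  by apply: is_deriveD; apply: is_deriveZ.
have dB : is_derive s 1 B (p * (2 * Num.sqrt s)^-1 -
    q / 2 * (- (Num.sqrt s) ^- 2 *: (2 * Num.sqrt s)^-1)).
  by apply: is_deriveB; apply: is_deriveZ.
have dNA := @is_derive1_comp R gcdf A s _ _ (is_derive_gcdf (A s)) dA.
have dNB := @is_derive1_comp R gcdf B s _ _ (is_derive_gcdf (B s)) dB.
have dF : is_derive s 1 F _ := is_deriveD (is_deriveZ (expR (p * q)) dNA)
   (is_deriveZ (expR (- (p * q))) dNB).
apply: (is_derive_eq dF); rewrite /f /Ka.
have rs : Num.sqrt s ^+ 2 = s by rewrite sqr_sqrtr// ltW.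
have -> : - A s ^+ 2 = - (p ^+ 2 * s) + - q ^+ 2 / (4 * s) - p * q.
  rewrite /A -[in RHS]rs; field.
  by rewrite gt_eqF.
have -> : - B s ^+ 2 = - (p ^+ 2 * s) + - q ^+ 2 / (4 * s) + p * q.
  rewrite /B -[in RHS]rs; field.
  by rewrite gt_eqF.
rewrite mul0r addr0 !expRD (expRN (p * q)) (expRN (p ^+ 2 * s)).
rewrite (_ : 4 * pi * s = 2 ^+ 2 * pi * s); last by congr (_ * _ * _); rewrite expr2 -natrM.
have -> : Num.sqrt (2 ^+ 2 * pi * s) = 2 * Num.sqrt pi * Num.sqrt s.
  by rewrite sqrtrM ?mulr_ge0 ?pi_ge0// sqrtrM// sqrtr_sqr ger0_norm.
have pi0 : Num.sqrt (pi : R) != 0 by rewrite gt_eqF// sqrtr_gt0 pi_gt0.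
have e0 : expR (p * q) != 0 by rewrite gt_eqF// expR_gt0.
rewrite /GRing.scale/=; field.
by rewrite pi0 e0 !gt_eqF ?expR_gt0.
Qed.

Let cvg_sqrty : Num.sqrt x @[x --> +oo] --> (+oo : set_system R).
Proof.
apply/cvgryPge => M; near=> x.
have M0 : 0 <= Num.max M 0 by rewrite le_max lexx orbT.
apply: (@le_trans _ _ (Num.max M 0)); first by rewrite le_max lexx.
rewrite -(ler_sqr M0) ?nnegrE ?sqrtr_ge0// sqr_sqrtr; near: x.
  by apply: nbhs_pinfty_ge; rewrite num_real.
by apply: nbhs_pinfty_ge; rewrite num_real.
Unshelve. all: by end_near. Qed.

Let cvg_Fy : F x @[x --> +oo] --> expR (p * q) + expR (- (p * q)).
Proof.
rewrite -[X in _ --> X + _]mulr1 -[X in _ --> _ + X]mulr1.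
have pq0 : 0 < q / 2 by rewrite divr_gt0.
have /cvgryPge sy := cvg_sqrty.
apply: cvgD; apply: cvgM; try exact: cvg_cst.
  apply: (cvg_comp A gcdf) gcdf_cvgy.
  apply/cvgryPge => M; have := sy (M / p); apply: filterS => x.
  rewrite ler_pdivrMr// mulrC => /le_trans; apply.
  by rewrite /A lerDl mulr_ge0 ?invr_ge0 ?sqrtr_ge0// ltW.
apply: (cvg_comp B gcdf) gcdf_cvgy.
(* Once [Num.sqrt x >= 1], the subtracted term of [B] is at most [q / 2]. *)
apply/cvgryPge => M; have := sy ((M + q / 2) / p); have := sy 1.
apply: filterS2 => x x1.
rewrite ler_pdivrMr// [_ * p]mulrC -lerBrDr => /le_trans; apply.
have x0 : 0 < Num.sqrt x by rewrite (lt_le_trans _ x1).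
rewrite /B; apply: lerB => //.
by rewrite ler_piMr ?(ltW pq0)// invf_le1.
Qed.

Let e (n : nat) : R := (n.+1%:R^-1) ^+ 2.

Let e_gt0 n : 0 < e n. Proof. by rewrite exprn_gt0// invr_gt0. Qed.

Let sqrt_e n : Num.sqrt (e n) = n.+1%:R^-1.
Proof. by rewrite sqrtr_sqr ger0_norm// invr_ge0. Qed.

(** Near 0 on the right, [A] tends to +oo and [B] to -oo. The value [F 0] is a different number,
    because [0^-1 = 0] makes [A 0 = B 0 = 0]; hence a limit along positive points, squared so that
    their roots are explicit. *)
Let cvg_F0 : F (e n) @[n --> \oo] --> expR (p * q).
Proof.
rewrite -[X in _ --> X]addr0 -[X in _ --> X + _]mulr1 -[X in _ --> _ + X](mulr0 (expR (- (p * q)))).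
have q2 : 0 < q / 2 by rewrite divr_gt0.
apply: cvgD; apply: cvgM; try exact: cvg_cst.
  apply: (cvg_comp (A \o e) gcdf) gcdf_cvgy.
  apply/cvgryPge => M; near=> n.
  rewrite /= /A sqrt_e invrK; apply: (@le_trans _ _ (q / 2 * n.+1%:R)).
    rewrite -ler_pdivrMl// (@le_trans _ _ n%:R) ?ler_nat//; near: n; exact: nbhs_infty_ger.
  by rewrite lerDr mulr_ge0 ?invr_ge0// ltW.
apply: (cvg_comp (B \o e) gcdf) gcdf_cvgNy.
apply/cvgrNyPle => M; near=> n.
rewrite /= /B sqrt_e invrK; apply: (@le_trans _ _ (p - q / 2 * n.+1%:R)).
  by apply: lerB => //; rewrite ler_piMr ?(ltW p0)// invf_le1// ler1n.
rewrite lerBlDr -lerBlDl -ler_pdivrMl// (@le_trans _ _ n%:R) ?ler_nat//.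
by near: n; exact: nbhs_infty_ger.
Unshelve. all: by end_near. Qed.

Lemma laplace_heat_pos :
  (\int[mu]_s (expR (- (p ^+ 2 * s)) * Ka 0 s q)%:E =
   (expR (- (p * q)) / (2 * p))%:E)%E.
Proof.
have f_ge0 s : 0 <= f s.
  by rewrite /f !mulr_ge0 ?Ka_ge0 ?expR_ge0// ltW.
have mf : measurable_fun setT f.
  apply: measurable_funM => //; apply: measurable_funM.
    by apply: measurableT_comp => //; apply: measurableT_comp => //; exact: measurable_funM.
  exact: measurable_Ka_comp.
have mfE : measurable_fun setT (EFin \o f) by exact/measurable_EFinP.
have cf s : 0 < s -> {for s, continuous f}.
  move=> s0; rewrite /f.
  have c4 : {for s, continuous (fun s : R => 4 * s)}.
    by apply: cvgM; [exact: cvg_cst|exact: cvg_id].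
  have c4p : {for s, continuous (fun s : R => 4 * pi * s)}.
    by apply: cvgM; [exact: cvg_cst|exact: cvg_id].
  apply: cvgM; first exact: cvg_cst.
  apply: cvgM.
    apply: continuous_comp; last exact: continuous_expR.
    by apply: cvgN; apply: cvgM; [exact: cvg_cst|exact: cvg_id].
  rewrite /Ka; apply: cvgM.
    apply: cvgV; first by rewrite gt_eqF// sqrtr_gt0 !mulr_gt0 ?pi_gt0.
    apply: continuous_comp; first exact: c4p.
    exact: sqrt_continuous.
  apply: continuous_comp; last exact: continuous_expR.
  apply: cvgD; last exact: cvg_cst.
  apply: cvgM; first exact: cvg_cst.
  by apply: cvgV; [rewrite gt_eqF// mulr_gt0|exact: c4].
(* [F] is not continuous at 0, so the fundamental theorem is applied away from 0 and the left
   endpoint is reached by monotone convergence. *)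
have If n : (\int[mu]_(s in `[e n, +oo[) (f s)%:E =
    (expR (p * q) + expR (- (p * q)))%:E - (F (e n))%:E)%E.
  apply: ge0_continuous_FTC2y => //.
  - apply: continuous_in_subspaceT => x; rewrite inE/= in_itv/= andbT => ex.
    by apply: cf; exact: lt_le_trans ex.
  - by move=> x ex; have [] := F' (lt_trans (e_gt0 n) ex).
  - apply: cvg_at_right_filter; have [+ _] := F' (e_gt0 n).
    by move=> /derivable1_diffP/differentiable_continuous.
  - move=> x; rewrite in_itv/= andbT => ex.
    by rewrite derive1E; have [_ ->] := F' (lt_trans (e_gt0 n) ex).
have U : \bigcup_n `[e n, +oo[%classic = `]0%R, +oo[%classic.
  apply/seteqP; split => x /=.
    by move=> [n _ /=]; rewrite !in_itv/= !andbT; exact: lt_le_trans.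
  rewrite in_itv/= andbT => x0; exists (Num.truncn (x^-1)) => //=.
  rewrite in_itv/= andbT /e; set m := (Num.truncn _).+1.
  have xm : x^-1 < m%:R by rewrite /m truncnS_gt.
  have m1 : 1 <= m%:R :> R by rewrite ler1n.
  apply: (@le_trans _ _ (m%:R^-1)).
    by rewrite expr2 ler_piMl ?invr_ge0// invf_le1// (lt_le_trans _ m1).
  by rewrite -[leRHS]invrK lef_pV2 ?posrE ?invr_gt0// ltW.
have L : (\int[mu]_(s in `]0%R, +oo[) (f s)%:E = (expR (- (p * q)))%:E)%E.
  rewrite -U.
  have H : (\int[mu]_(s in `[e n, +oo[) (f s)%:E)%E @[n --> \oo] -->
     (\int[mu]_(s in \bigcup_n `[e n, +oo[%classic) (f s)%:E)%E.
    apply: (@ge0_nondecreasing_set_cvg_integral _ (measurableTypeR R) R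
      (fun n => `[e n, +oo[%classic) (EFin \o f) mu) => //.
    - apply/nondecreasing_seqP => n; rewrite subsetEset; apply: subset_itvr.
      by rewrite bnd_simp /e ler_sqr ?nnegrE ?invr_ge0// lef_pV2 ?posrE// ler_nat.
    - by move=> n; exact: (measurable_funTS (f := EFin \o f) mfE).
    - by move=> n x _; rewrite /= lee_fin.
  apply: (cvg_unique _ H) => //.
  rewrite (_ : (fun n => _) = fun n =>
    (expR (p * q) + expR (- (p * q)) - F (e n))%:E); last first.
    by apply/funext => n; rewrite EFinB; exact: If.
  apply: cvg_EFin; first by near=> n.
  rewrite [X in _ --> X](_ : _ = expR (p * q) + expR (- (p * q)) - expR (p * q)); last by rewrite addrAC subrr add0r.
  by apply: cvgB => //; exact: cvg_cst.
have T : (\int[mu]_s (f s)%:E = (expR (- (p * q)))%:E)%E.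
  rewrite -L [RHS]integral_mkcond; apply: eq_integral => s _.
  rewrite patchE; case: ifPn => //; rewrite notin_setE/= in_itv/= andbT => /negP.
  by rewrite -leNgt => s0; rewrite /f Ka_le0// !mulr0.
rewrite (_ : expR _ / _ = (2 * p)^-1 * expR (- (p * q))); last by rewrite mulrC.
rewrite EFinM -T -ge0_integralZl//.
- apply: eq_integral => s _; rewrite -EFinM; congr EFin.
  by rewrite /f; field; rewrite gt_eqF.
- by move=> s _; rewrite lee_fin.
- by rewrite lee_fin invr_ge0 mulr_ge0// ltW.
Unshelve. all: by end_near. Qed.

End LaplaceHeat.

(** * Integrals of exponentials over intervals *)

Section ExpIntegrals.
Context {R : realType}.
Notation mu := (@lebesgue_measure R).
Implicit Types c d k l : R.

Let E k l z := expR (k * z + l).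

Let dE k l (z : R) : k != 0 -> is_derive z 1 (fun z : R => k^-1 * E k l z) (E k l z).
Proof.
move=> k0; have dl : is_derive z 1 (fun z : R => k * z + l) (k * 1 + 0).
  by apply: is_deriveD; apply: is_deriveZ.
have de := @is_derive1_comp R expR _ z _ _ (is_derive_expR _) dl.
apply: (is_derive_eq (is_deriveZ (k^-1) de)).
by rewrite /E /GRing.scale/= addr0 mulr1 mulrCA mulVf ?mulr1.
Qed.

Let cE k l : continuous (E k l).
Proof.
move=> z; apply: continuous_comp; last exact: continuous_expR.
by apply: cvgD; [apply: cvgM; [exact: cvg_cst|exact: cvg_id]|exact: cvg_cst].
Qed.

Lemma integral_expR_itvcc c d k l : c < d -> k != 0 ->
  (\int[mu]_(z in `[c, d]) (expR (k * z + l))%:E =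
   (k^-1 * (expR (k * d + l) - expR (k * c + l)))%:E)%E.
Proof.
move=> cd k0; rewrite mulrBr EFinB.
apply: (continuous_FTC2 (F := fun z => k^-1 * E k l z)) => //.
- by apply: continuous_subspaceT; exact: cE.
- have cF : continuous (fun z : R => k^-1 * E k l z).
    by move=> z; apply: cvgM; [exact: cvg_cst|exact: cE].
  split.
  + by move=> z _; have [] := dE l z k0.
  + apply: cvg_at_right_filter; exact: cF.
  + apply: cvg_at_left_filter; exact: cF.
- by move=> z _; rewrite derive1E; have [_ ->] := dE l z k0.
Qed.

Lemma integral_expR_itvcy c k l : k < 0 ->
  (\int[mu]_(z in `[c, +oo[) (expR (k * z + l))%:E =
   (- (k^-1 * expR (k * c + l)))%:E)%E.
Proof.
move=> k0; rewrite (_ : (- _)%:E = (0%R%:E - (k^-1 * E k l c)%:E)%E); last first.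
  by rewrite -EFinB sub0r.
have k0' : k != 0 by rewrite lt_eqF.
have cF : continuous (fun z : R => k^-1 * E k l z).
  by move=> z; apply: cvgM; [exact: cvg_cst|exact: cE].
apply: (@ge0_continuous_FTC2y R _ (fun z : R => k^-1 * E k l z)) => //.
- by apply: continuous_subspaceT; exact: cE.
- rewrite -[X in _ --> X](mulr0 k^-1); apply: cvgM; first exact: cvg_cst.
  rewrite (_ : E k l = fun z => expR (- ((- k) * z - l))); last first.
    by apply/funext => z; rewrite /E; congr expR; ring.
  apply: (cvg_comp (fun z => (- k) * z - l) (fun y => expR (- y))) (@cvgr_expR R).
  apply/cvgryPge => M; near=> z.
  rewrite lerBrDr -ler_pdivrMl ?oppr_gt0//; near: z.
- apply: cvg_at_right_filter; exact: cF.
- by move=> z _; rewrite derive1E; have [_ ->] := dE l z k0'.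
Unshelve. all: by end_near. Qed.

End ExpIntegrals.

(** * Laplace transform in time of the weight *)

Section LaplaceWa.
Context {R : realType}.
Notation mu := (@lebesgue_measure R).
Implicit Types a p q x : R.

Lemma Ka0N t u : Ka 0 t (- u) = Ka 0 t u :> R.
Proof. by rewrite /Ka sqrrN !mul0r. Qed.

Lemma laplace_heat p q : 0 < p -> q != 0 ->
  (\int[mu]_s (expR (- (p ^+ 2 * s)) * Ka 0 s q)%:E =
   (expR (- (p * `|q|)) / (2 * p))%:E)%E.
Proof.
move=> p0 q0; rewrite -laplace_heat_pos ?normr_gt0//.
apply: eq_integral => s _; case: (ger0P q) => // _.
by rewrite Ka0N.
Qed.

(** The resolvent kernel e^(a(x-z) - p|x-z|) / (2p) integrated over z >= 0. The two branches record
    whether the kink z = x falls in the interior of the half-line. *)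
Definition wlap a p x := if x <= 0 then expR ((a + p) * x) / (2 * p * (p + a))
  else (p ^+ 2 - a ^+ 2)^-1 - expR ((a - p) * x) / (2 * p * (p - a)).

Lemma laplace_wa a p x : `|a| < p ->
  (\int[mu]_s (expR (- (p ^+ 2 * s)) * wa a s x)%:E = (wlap a p x)%:E)%E.
Proof.
rewrite ltr_norml => /andP[pa ap].
have p0 : 0 < p by lra.
have pa0 : 0 < p + a by lra.
have pma0 : 0 < p - a by lra.
pose f (w : R * R) := (expR (- (p ^+ 2 * w.1)) *
  (Ka a w.1 (x - w.2) * (0 <= w.2)%R%:R)).
have mf : measurable_fun setT (EFin \o f).
  apply/measurable_EFinP; apply: measurable_funM.
    apply: measurableT_comp => //; apply: measurableT_comp => //.
    exact: measurable_funM.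
  apply: measurable_funM.
    by apply: measurable_Ka_comp => //; exact: measurable_funB.
  apply: (measurableT_comp (f := fun b : bool => b%:R : R)) => //.
  exact: measurable_fun_ler.
have f0 w : (0 <= (EFin \o f) w)%E.
  by rewrite lee_fin !mulr_ge0// ?expR_ge0 ?Ka_ge0.
pose g z := expR (a * (x - z)) * (expR (- (p * `|x - z|)) / (2 * p)).
have mg : measurable_fun setT g.
  apply: measurable_funM.
    apply: measurableT_comp => //; apply: measurable_funM => //.
    exact: measurable_funB.
  apply: measurable_funM => //; apply: measurableT_comp => //.
  apply: measurableT_comp => //; apply: measurable_funM => //.
  by apply: measurableT_comp => //; exact: measurable_funB.
transitivity (\int[mu]_z (g z * (0 <= z)%R%:R)%:E)%E.
  transitivity (\int[mu]_s \int[mu]_z (EFin \o f) (s, z))%E.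
    apply: eq_integral => s _; rewrite EFinM waE -ge0_integralZl//.
    - apply/measurable_EFinP; apply: measurable_funM.
        by apply: measurable_Ka_comp => //; exact: measurable_funB.
      apply: (measurableT_comp (f := fun b : bool => b%:R : R)) => //.
      exact: measurable_fun_ler.
    - by move=> z _; rewrite lee_fin mulr_ge0// Ka_ge0.
  rewrite (fubini_tonelli (m1 := mu) (m2 := mu) (EFin \o f))//.
  have mG := measurable_fun_fubini_tonelli_G (m1 := mu) (EFin \o f) mf f0.
  have mg' : measurable_fun setT (fun z : R => (g z * (0 <= z)%R%:R)%:E).
    apply/measurable_EFinP; apply: measurable_funM => //.
    apply: (measurableT_comp (f := fun b : bool => b%:R : R)) => //.
    exact: measurable_fun_ler.
  have g0 z : (0 <= (g z * (0 <= z)%R%:R)%:E)%E.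
    rewrite lee_fin /g mulr_ge0// mulr_ge0 ?expR_ge0// mulr_ge0 ?expR_ge0//.
    by rewrite invr_ge0 mulr_ge0// ltW.
  apply: ge0_ae_eq_integral;
    [exact: measurableT|exact: mG|exact: mg'| |by move=> z _; exact: g0|].
    by move=> z _; exact: integral_ge0.
  (* The transform of the kernel is only known for a nonzero displacement; the single point [z = x]
     is negligible. *)
  exists [set x]; split; first exact: measurable_set1.
    exact: lebesgue_measure_set1.
  move=> z /=; apply: contra_notP => /eqP; rewrite eq_sym => xz _.
  transitivity (\int[mu]_s ((expR (a * (x - z)) * (0 <= z)%R%:R)%:E *
      (expR (- (p ^+ 2 * s)) * Ka 0 s (x - z))%:E))%E.
    apply: eq_integral => s _; rewrite /= /f/= -EFinM; congr EFin.
    by rewrite -(Ka_shift 0 a) subr0; ring.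
  rewrite ge0_integralZl//.
  - by rewrite laplace_heat ?subr_eq0// -EFinM /g; congr EFin; ring.
  - apply/measurable_EFinP; apply: measurable_funM.
      by apply: measurableT_comp => //; apply: measurableT_comp => //; exact: measurable_funM.
    exact: measurable_Ka_comp.
  - by move=> s _; rewrite lee_fin mulr_ge0 ?expR_ge0 ?Ka_ge0.
rewrite integral_mulb (_ : [set z | 0 <= z] = `[0, +oo[%classic); last first.
  by apply/seteqP; split => z /=; rewrite in_itv/= andbT.
have g_left z : x <= z -> (g z)%:E =
    ((2 * p)^-1%:E * (expR (- (a + p) * z + (a + p) * x))%:E)%E.
  move=> xz; rewrite -EFinM; congr EFin.
  rewrite /g ler0_norm ?subr_le0// mulrA -expRD mulrC.
  by congr (_ * expR _); ring.
have g_right z : z <= x -> (g z)%:E =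
    ((2 * p)^-1%:E * (expR ((p - a) * z + (a - p) * x))%:E)%E.
  move=> xz; rewrite -EFinM; congr EFin.
  rewrite /g ger0_norm ?subr_ge0// mulrA -expRD mulrC.
  by congr (_ * expR _); ring.
have mexp (k l : R) (D : set R) : measurable_fun D (fun z => (expR (k * z + l))%:E).
  apply/measurable_EFinP; apply: measurable_funTS.
  by apply: measurableT_comp => //; apply: measurable_funD => //; exact: measurable_funM.
have p2 : (0 <= ((2 * p)^-1)%:E)%E by rewrite lee_fin invr_ge0 mulr_ge0// ltW.
rewrite /wlap; case: ifPn => [x0|].
  under eq_integral => z /[!inE]/=.
    rewrite in_itv/= andbT => z0.
    rewrite (g_left z (le_trans x0 z0)); over.
  rewrite ge0_integralZl//; last exact: mexp.
  rewrite integral_expR_itvcy ?oppr_lt0 1?addrC// -EFinM; congr EFin.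
  rewrite mulr0 add0r; field; rewrite !gt_eqF//.
rewrite -ltNge => x0.
rewrite (@itv_bndbnd_setU _ _ _ (BRight x))// ?bnd_simp ?(ltW x0)//.
rewrite ge0_integral_setU//; last 3 first.
- by apply/measurable_EFinP; exact: measurable_funTS.
- by move=> z _; rewrite lee_fin /g !mulr_ge0 ?invr_ge0 ?expR_ge0// mulr_ge0// ltW.
- apply/disj_setPS => z /= []; rewrite !in_itv/= andbT => /andP[_ zx].
  by rewrite ltNge zx.
have -> : (\int[mu]_(z in `[0%R, x]) (g z)%:E =
    ((2 * p)^-1 * ((p - a)^-1 * (1 - expR ((a - p) * x))))%:E)%E.
  under eq_integral => z /[!inE]/=.
    rewrite in_itv/= => /andP[_ zx]; rewrite (g_right z zx); over.
  rewrite ge0_integralZl//; last exact: mexp.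
  rewrite integral_expR_itvcc ?gt_eqF// -EFinM mulr0 add0r; congr (_ * (_ * (_ - _)))%:E.
  by rewrite -[RHS]expR0; congr expR; ring.
have -> : (\int[mu]_(z in `]x, +oo[) (g z)%:E = ((2 * p)^-1 * (p + a)^-1)%:E)%E.
  under eq_integral => z /[!inE]/=.
    rewrite in_itv/= andbT => zx; rewrite (g_left z (ltW zx)); over.
  rewrite ge0_integralZl//; last exact: mexp.
  rewrite integral_itv_obnd_cbnd//.
  rewrite integral_expR_itvcy ?oppr_lt0 1?addrC// -EFinM; congr EFin.
  rewrite mulNr addNr expR0; field; rewrite !gt_eqF//.
rewrite -EFinD; congr EFin; field.
by rewrite !gt_eqF// (_ : p ^+ 2 - a ^+ 2 = (p - a) * (p + a)) ?mulr_gt0//; ring.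
Qed.

End LaplaceWa.

(** * The transform of the vanishing final value *)

Section VaLaplace.
Context {R : realType}.
Notation mu := (@lebesgue_measure R).
Variables (a T m : R) (f : R -> R).
Hypotheses (T_gt0 : 0 < T) (mf : measurable_fun setT f).
Hypothesis intf : mu.-integrable setT (EFin \o (fun x => f x * expR ((m - a) * x))).

Let Psi (w : (R * R) * R) :=
  Ka a (T - w.1.1) (w.2 - w.1.2) * (wa a w.1.1 w.1.2 * f w.1.2).

Let mPsi : measurable_fun setT Psi.
Proof.
apply: measurable_funM.
  apply: measurable_Ka_comp; apply: measurable_funB => //; exact: measurableT_comp.
apply: measurable_funM.
  exact: (measurableT_comp (measurable_wa a) measurable_fst).
by apply: measurableT_comp => //; exact: measurableT_comp.
Qed.

(** The normalization by [expR (- (m ^+ 2 * T))] reduces the kernel mass [expR (m ^+ 2 * (T - s))]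
    to [expR (- (m ^+ 2 * s))]: once [y] is integrated out, the only trace of [T] is the cut
    [s < T]. *)
Let Phi (w : (R * R) * R) := expR ((m - a) * w.2 - m ^+ 2 * T) * Psi w.

Let mPhi : measurable_fun setT Phi.
Proof.
apply: measurable_funM => //; apply: measurableT_comp => //.
by apply: measurable_funB => //; exact: measurable_funM.
Qed.

Let Ua_out s y : ~~ (0 < s < T) -> Ua a (T - s) (fun x => wa a s x * f x) y = 0.
Proof.
move=> sT; rewrite /Ua /Rintegral integral0_eq// => x _; congr EFin.
move: sT; rewrite negb_and -!leNgt => /orP[s0|Ts].
  by rewrite wa_le0// mul0r mulr0.
by rewrite Ka_le0 ?mul0r// subr_le0.
Qed.

Let VaE y : Va a T f y = \int[mu]_s \int[mu]_x Psi ((s, x), y).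
Proof.
rewrite /Va Rintegral_mkcond; apply: eq_Rintegral => s _.
rewrite patchE; case: ifPn => //; rewrite notin_setE/= in_itv/= => /negP sT.
by rewrite -[RHS]/(Ua a (T - s) (fun x => wa a s x * f x) y) Ua_out.
Qed.

Let expR_split y : expR ((m - a) * y - m ^+ 2 * T) =
  expR (- (m ^+ 2 * T)) * expR ((m - a) * y).
Proof. by rewrite -expRD; congr expR; ring. Qed.

Let expR_merge s : expR (m ^+ 2 * (T - s)) * expR (- (m ^+ 2 * T)) = expR (- (m ^+ 2 * s)).
Proof. by rewrite -expRD; congr expR; ring. Qed.

Let Phi_y s x : (\int[mu]_y `|Phi ((s, x), y)|%:E =
  ((s < T)%R%:R * (expR (- (m ^+ 2 * s)) * wa a s x) * `|f x * expR ((m - a) * x)|)%:E)%E.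
Proof.
have [sT|Ts] := ltP s T; last first.
  rewrite !mul0r integral0_eq// => y _.
  by rewrite /Phi /Psi/= Ka_le0 ?subr_le0// mul0r mulr0 normr0.
transitivity (\int[mu]_y ((expR (- (m ^+ 2 * T)) * wa a s x * `|f x|)%:E *
    (Ka a (T - s) (y - x) * expR ((m - a) * y))%:E))%E.
  apply: eq_integral => y _; rewrite -EFinM; congr EFin.
  rewrite /Phi /Psi/= normrM (ger0_norm (expR_ge0 _)) normrM (ger0_norm (Ka_ge0 _ _ _)).
  by rewrite normrM (ger0_norm (wa_ge0 _ _ _)) expR_split; ring.
rewrite ge0_integralZl//.
- rewrite integral_Ka_translate ?subr_gt0// -EFinM; congr EFin.
  by rewrite normrM (ger0_norm (expR_ge0 ((m - a) * x))) mul1r -(expR_merge s); ring.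
- apply/measurable_EFinP; apply: measurable_funM.
    by apply: measurable_Ka_comp => //; exact: measurable_funB.
  by apply: measurableT_comp => //; exact: measurable_funM.
- by move=> y _; rewrite lee_fin mulr_ge0 ?Ka_ge0 ?expR_ge0.
- by rewrite lee_fin !mulr_ge0 ?wa_ge0 ?expR_ge0.
Qed.

Let Phi_yR s x : \int[mu]_y Phi ((s, x), y) =
  (s < T)%R%:R * (expR (- (m ^+ 2 * s)) * wa a s x) * (f x * expR ((m - a) * x)).
Proof.
have [sT|Ts] := ltP s T; last first.
  rewrite !mul0r /Rintegral integral0_eq// => y _.
  by rewrite /Phi /Psi/= Ka_le0 ?subr_le0// mul0r mulr0.
have iK : mu.-integrable setT (EFin \o (fun y => Ka a (T - s) (y - x) * expR ((m - a) * y))).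
  apply/integrableP; split.
    apply/measurable_EFinP; apply: measurable_funM.
      by apply: measurable_Ka_comp => //; exact: measurable_funB.
    by apply: measurableT_comp => //; exact: measurable_funM.
  under eq_integral => y _ do rewrite /= ger0_norm ?mulr_ge0 ?Ka_ge0 ?expR_ge0//.
  by rewrite integral_Ka_translate ?subr_gt0// ltry.
transitivity (\int[mu]_y ((expR (- (m ^+ 2 * T)) * wa a s x * f x) *
    (Ka a (T - s) (y - x) * expR ((m - a) * y)))).
  by apply: eq_Rintegral => y _; rewrite /Phi /Psi/= expR_split; ring.
rewrite RintegralZl// /Rintegral integral_Ka_translate ?subr_gt0//=.
by rewrite mul1r -(expR_merge s); ring.
Qed.

(** On [0 < s < T] the time factor is at most 1 and the weight at most [expR (a ^+ 2 * T)], so the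
    triple integral is at most [C * T] times the weighted norm of [f]. *)
Let Phi_lty :
  (\int[mu]_x \int[mu]_s \int[mu]_y `|Phi ((s, x), y)|%:E < +oo)%E.
Proof.
pose C := expR (a ^+ 2 * T).
pose h x := `|f x * expR ((m - a) * x)|.
have mh : measurable_fun setT h.
  by move/integrableP : intf => [/measurable_EFinP mfe _]; exact: measurableT_comp.
have mPy : measurable_fun setT (fun w : R * R => (\int[mu]_y `|Phi (w, y)|%:E)%E).
  apply: (measurable_fun_fubini_tonelli_F (m2 := mu) (fun w => `|Phi w|%:E)) => //.
  by apply/measurable_EFinP; exact: measurableT_comp.
apply: (@le_lt_trans _ _ (\int[mu]_x ((C * T)%:E * (h x)%:E))%E).
  apply: ge0_le_integral => //.
  - by move=> x _; apply: integral_ge0 => s _; exact: integral_ge0.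
  - apply: (measurable_fun_fubini_tonelli_G (m1 := mu)
      (fun w : R * R => \int[mu]_y `|Phi (w, y)|%:E)%E) => //.
    by move=> w; exact: integral_ge0.
  - by apply/measurable_EFinP; exact: measurable_funM.
  - move=> x _; apply: (@le_trans _ _ (\int[mu]_(s in `]0%R, T[) (C * h x)%:E)%E).
      rewrite [leRHS]integral_mkcond; apply: ge0_le_integral => //.
      + by move=> s _; exact: integral_ge0.
      + exact: (measurable_fun_pair1 x mPy).
      + apply/(measurable_restrictT _ _).1 => //.
      + move=> s _; rewrite Phi_y patchE; case: ifPn.
          rewrite inE/= in_itv/= => /andP[s0 sT]; rewrite sT mul1r lee_fin.
          rewrite ler_wpM2r// -[leRHS]mul1r ler_pM ?expR_ge0 ?wa_ge0//.
            by rewrite -expR0 ler_expR oppr_le0 mulr_ge0 ?sqr_ge0// ltW.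
          apply: (le_trans (wa_le _ _ _)).
          by rewrite ler_expR ler_wpM2l ?sqr_ge0// ltW.
        rewrite notin_setE/= in_itv/= => /negP; rewrite negb_and -!leNgt => /orP[s0|sT].
          by rewrite wa_le0// !mulr0 mul0r.
        by rewrite ltNge sT !mul0r.
    rewrite integral_cst//= lebesgue_measure_itv/= lte_fin T_gt0 oppr0 adde0.
    by rewrite -!EFinM lee_fin mulrAC.
rewrite integralZl//; last exact: integrable_norm intf.
apply: lte_mul_pinfty => //.
  by rewrite lee_fin !mulr_ge0 ?expR_ge0// ltW.
by move/integrableP : intf => [].
Qed.

Hypothesis Va0 : {ae mu, forall y, Va a T f y = 0}.

Let triple0 : \int[mu]_x \int[mu]_s \int[mu]_y Phi ((s, x), y) = 0.
Proof.
apply: (@triple_Rintegral_eq0 _ _ _ _ _ _ R mu mu mu Phi) => //.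
move: Va0; apply: filterS; first exact: (ae_filter_ringOfSetsType mu).
move=> y Vy iPhi.
(* For fixed [y] the test weight is a positive constant and divides out. *)
have iPsi : (mu \x mu)%E.-integrable setT (EFin \o (fun w => Psi (w, y))).
  have := integrableZl measurableT (expR (- ((m - a) * y - m ^+ 2 * T))) iPhi.
  apply: eq_integrable => // w _; rewrite /= -EFinM /Phi/= mulrA -expRD.
  by rewrite addNr expR0 mul1r.
rewrite /Phi/= RintegralZl//.
by rewrite -(Rintegral12_prod_meas iPsi) -VaE Vy mulr0.
Qed.

Lemma Va_eq0_laplace : \int[mu]_x (f x * expR ((m - a) * x) *
  \int[mu]_s ((s < T)%R%:R * (expR (- (m ^+ 2 * s)) * wa a s x))) = 0.
Proof.
have iH x : mu.-integrable setT
    (EFin \o (fun s => (s < T)%R%:R * (expR (- (m ^+ 2 * s)) * wa a s x))).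
  apply: (@le_integrable _ _ _ mu _ measurableT _
     (fun s => ((cst (expR (a ^+ 2 * T)) \_ `]0, T[) s)%:E)).
  - apply/measurable_EFinP; apply: measurable_funM.
      apply: (measurableT_comp (f := fun b : bool => b%:R : R)) => //.
      exact: measurable_fun_ltr.
    apply: measurable_funM.
      by apply: measurableT_comp => //; apply: measurableT_comp => //; exact: measurable_funM.
    exact: (measurable_fun_pair1 x (measurable_wa a)).
  - move=> s _; rewrite /= lee_fin patchE; case: ifPn.
      rewrite inE/= in_itv/= => /andP[s0 sT]; rewrite sT mul1r.
      rewrite ger0_norm ?mulr_ge0 ?expR_ge0 ?wa_ge0// ger0_norm ?expR_ge0//.
      rewrite -[leRHS]mul1r ler_pM ?expR_ge0 ?wa_ge0//.
        by rewrite -expR0 ler_expR oppr_le0 mulr_ge0 ?sqr_ge0// ltW.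
      apply: (le_trans (wa_le _ _ _)).
      by rewrite ler_expR ler_wpM2l ?sqr_ge0// ltW.
    rewrite notin_setE/= in_itv/= => /negP; rewrite negb_and -!leNgt => /orP[s0|sT].
      by rewrite wa_le0// !mulr0.
    by rewrite ltNge sT !mul0r.
  - rewrite [X in mu.-integrable _ X](_ : _ =
        (EFin \o cst (expR (a ^+ 2 * T))) \_ `]0, T[); last by rewrite restrict_EFin.
    apply/(integrable_mkcond _ _).1 => //; apply/integrableP; split.
      exact: (@measurable_cst _ _ _ _ _ (expR (a ^+ 2 * T))%:E).
    rewrite [X in (X < _)%E](_ : _ =
      \int[mu]_(s in `]0%R, T[) (`|expR (a ^+ 2 * T)|%:E))%E//.
    rewrite integral_cst//= lebesgue_measure_itv/= lte_fin T_gt0.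
    by rewrite -EFinB -EFinM ltry.
rewrite -[RHS]triple0; apply: eq_Rintegral => x _.
rewrite -RintegralZl//; apply: eq_Rintegral => s _.
by rewrite Phi_yR mulrC.
Qed.

End VaLaplace.

Lemma integrable_mulr_bounded d (T : measurableType d) (R : realType)
    (m : {measure set T -> \bar R}) (F G : T -> R) (K : R) :
  m.-integrable setT (EFin \o F) -> measurable_fun setT G ->
  (forall x, `|G x| <= K) ->
  m.-integrable setT (EFin \o (fun x => F x * G x)).
Proof.
move=> iF mG GK; have /integrableP[/measurable_EFinP mF _] := iF.
apply: (le_integrable measurableT (g := fun x => (K%:E * (F x)%:E)%E)).
- by apply/measurable_EFinP; exact: measurable_funM.
- move=> x _; rewrite /= lee_fin !normrM mulrC ler_wpM2r//.
  by rewrite (le_trans (GK x))// ler_norm.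
- exact: integrableZl.
Qed.

(** * From the time integral cut at [T] to the full one *)

Section LaplaceBound.
Context {R : realType}.
Notation mu := (@lebesgue_measure R).
Variables (a p : R).
Hypothesis ap : `|a| < p.

Let p_gt0 : 0 < p. Proof. exact: le_lt_trans ap. Qed.

Let pa_gt0 : 0 < p ^+ 2 - a ^+ 2.
Proof.
move: ap; rewrite ltr_norml => /andP[pa pa'].
rewrite (_ : p ^+ 2 - a ^+ 2 = (p - a) * (p + a)); last by ring.
by rewrite mulr_gt0//; lra.
Qed.

Let G s x := expR (- (p ^+ 2 * s)) * wa a s x.

Let G_ge0 s x : 0 <= G s x.
Proof. by rewrite mulr_ge0 ?expR_ge0 ?wa_ge0. Qed.

Let mG : measurable_fun setT (fun w : R * R => G w.1 w.2).
Proof.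
apply: measurable_funM; last exact: measurable_wa.
by apply: measurableT_comp => //; apply: measurableT_comp => //; exact: measurable_funM.
Qed.

Let mGx x : measurable_fun setT (G ^~ x).
Proof. exact: (measurable_fun_pair1 x mG). Qed.

Let iG x : mu.-integrable setT (EFin \o (G ^~ x)).
Proof.
apply/integrableP; split; first by apply/measurable_EFinP; exact: mGx.
under eq_integral => s _ do rewrite /= ger0_norm//.
by rewrite laplace_wa// ltry.
Qed.

Let mb (P : R -> bool) : measurable_fun setT P ->
  measurable_fun setT (fun s => (P s)%:R : R).
Proof. by move=> mP; apply: (measurableT_comp (f := fun b : bool => b%:R : R)). Qed.

Let iPG (P : R -> bool) x : measurable_fun setT P ->
  mu.-integrable setT (EFin \o (fun s => (P s)%:R * G s x)).
Proof.
move=> mP; rewrite (_ : (fun s => _) = (fun s => G s x * (P s)%:R)); last first.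
  by apply/funext => s; rewrite mulrC.
apply: (integrable_mulr_bounded (K := 1)) => //; first exact: mb.
by move=> s; rewrite ger0_norm// lern1 leq_b1.
Qed.

Let mPG (P : R -> bool) : measurable_fun setT P ->
  measurable_fun setT (fun x => \int[mu]_s ((P s)%:R * G s x)).
Proof.
move=> mP; apply: (measurableT_comp (@fine_measurable _ setT _)) => //.
apply: (measurable_fun_fubini_tonelli_G (m1 := mu)
  (fun w : R * R => ((P w.1)%:R * G w.1 w.2)%:E)).
- apply/measurable_EFinP; apply: measurable_funM => //.
  by apply: (measurableT_comp (mb mP)).
- by move=> w; rewrite lee_fin mulr_ge0.
Qed.

Let mlt T : measurable_fun setT (fun s : R => s < T).
Proof. by apply: measurable_fun_ltr. Qed.

Let mge T : measurable_fun setT (fun s : R => T <= s).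
Proof. by apply: measurable_fun_ler. Qed.

Let tail_le T x : 0 <= T ->
  \int[mu]_s ((T <= s)%R%:R * G s x) <=
  expR (- ((p ^+ 2 - a ^+ 2) * T)) / (p ^+ 2 - a ^+ 2).
Proof.
move=> T0; rewrite -lee_fin /Rintegral fineK; last first.
  exact: integrable_fin_num (iPG x (mge T)).
apply: (@le_trans _ _ (\int[mu]_(s in `[T, +oo[)
    (expR ((a ^+ 2 - p ^+ 2) * s + 0))%:E)%E).
  under eq_integral => s _ do rewrite mulrC.
  rewrite integral_mulb (_ : [set s | T <= s] = `[T, +oo[%classic); last first.
    by apply/seteqP; split => z /=; rewrite in_itv/= andbT.
  apply: ge0_le_integral => //.
  - by move=> s _; rewrite lee_fin.
  - by apply/measurable_EFinP; apply: measurable_funTS; exact: mGx.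
  - apply/measurable_EFinP; apply: measurable_funTS.
    by apply: measurableT_comp => //; apply: measurable_funD => //; exact: measurable_funM.
  - move=> s _; rewrite lee_fin /G.
    rewrite (_ : _ + 0 = - (p ^+ 2 * s) + a ^+ 2 * s); last by ring.
    by rewrite expRD ler_wpM2l ?expR_ge0// wa_le.
rewrite integral_expR_itvcy -?oppr_gt0 ?opprB// lee_fin addr0.
rewrite (_ : a ^+ 2 - p ^+ 2 = - (p ^+ 2 - a ^+ 2)); last by rewrite opprB.
by rewrite invrN mulNr opprK mulNr mulrC.
Qed.

Let B T := expR (- ((p ^+ 2 - a ^+ 2) * T)) / (p ^+ 2 - a ^+ 2).

Let wlapE x : wlap a p x = \int[mu]_s G s x.
Proof. by rewrite /Rintegral laplace_wa. Qed.

Let wlap_split T x : wlap a p x =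
  \int[mu]_s ((s < T)%R%:R * G s x) + \int[mu]_s ((T <= s)%R%:R * G s x).
Proof.
rewrite wlapE -RintegralD//; [|exact: iPG (mlt T)|exact: iPG (mge T)].
by apply: eq_Rintegral => s _; case: ltP => _; rewrite ?mul1r ?mul0r ?addr0 ?add0r.
Qed.

Let PG_ge0 (P : R -> bool) x : 0 <= \int[mu]_s ((P s)%:R * G s x).
Proof. by apply: Rintegral_ge0 => s _; rewrite mulr_ge0. Qed.

Let wlap_le x : wlap a p x <= (p ^+ 2 - a ^+ 2)^-1.
Proof.
(* Cutting at time 0 turns the tail estimate into a bound on the whole transform, as [wa] vanishes
   at negative times. *)
rewrite (wlap_split 0) (_ : \int[mu]_s ((s < 0)%R%:R * G s x) = 0).
  by rewrite add0r (le_trans (tail_le _ _))// mulr0 oppr0 expR0 mul1r.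
rewrite /Rintegral integral0_eq// => s _; case: ltP => s0; rewrite ?mul0r//.
by rewrite mul1r /G wa_le0 ?mulr0// ltW.
Qed.

Let wlap_norm x : `|wlap a p x| <= (p ^+ 2 - a ^+ 2)^-1.
Proof. by rewrite ger0_norm ?wlap_le// (wlap_split 0) addr_ge0. Qed.

Lemma measurable_wlap : measurable_fun setT (wlap a p).
Proof.
rewrite (_ : wlap a p = fun x => \int[mu]_s ((s < 0)%R%:R * G s x) +
    \int[mu]_s ((0 <= s)%R%:R * G s x)).
  by apply: measurable_funD; [exact: mPG (mlt 0)|exact: mPG (mge 0)].
by apply/funext => x; exact: wlap_split.
Qed.

Lemma integrable_mul_wlap (F : R -> R) : mu.-integrable setT (EFin \o F) ->
  mu.-integrable setT (EFin \o (fun x => F x * wlap a p x)).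
Proof.
by move=> iF; apply: (integrable_mulr_bounded iF measurable_wlap wlap_norm).
Qed.

(** Times before [T] contribute nothing by [Va_eq0_laplace], so only the tail is left to estimate.
    The sign of [m] stays free: both choices are used later. *)
Lemma Va_eq0_bound (T m : R) (f : R -> R) : 0 < T -> measurable_fun setT f -> m ^+ 2 = p ^+ 2 ->
  mu.-integrable setT (EFin \o (fun x => f x * expR ((m - a) * x))) ->
  {ae mu, forall y, Va a T f y = 0} ->
  `|\int[mu]_x (f x * expR ((m - a) * x) * wlap a p x)| <=
  expR (- ((p ^+ 2 - a ^+ 2) * T)) / (p ^+ 2 - a ^+ 2) *
  \int[mu]_x `|f x * expR ((m - a) * x)|.
Proof.
move=> T0 mf mp iF V0; have F0 := Va_eq0_laplace T0 mf iF V0.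
rewrite mp in F0; move: iF F0.
pose F x := f x * expR ((m - a) * x).
rewrite -[EFin \o _]/(EFin \o F) => iF F0.
suff: `|\int[mu]_x (F x * wlap a p x)| <= B T * \int[mu]_x `|F x| by [].
pose J x := \int[mu]_s ((s < T)%R%:R * G s x).
pose K x := \int[mu]_s ((T <= s)%R%:R * G s x).
have K_norm x : `|K x| <= B T by rewrite ger0_norm ?PG_ge0// tail_le// ltW.
have J_norm x : `|J x| <= (p ^+ 2 - a ^+ 2)^-1.
  rewrite ger0_norm ?PG_ge0// (le_trans _ (wlap_le x))// (wlap_split T).
  by rewrite lerDl PG_ge0.
have iFJ : mu.-integrable setT (EFin \o (fun x => F x * J x)).
  apply: integrable_mulr_bounded; [exact: iF|exact: mPG (mlt T)|exact: J_norm].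
have iFK : mu.-integrable setT (EFin \o (fun x => F x * K x)).
  apply: integrable_mulr_bounded; [exact: iF|exact: mPG (mge T)|exact: K_norm].
have -> : \int[mu]_x (F x * wlap a p x) = \int[mu]_x (F x * K x).
  rewrite -[RHS]add0r -F0 -RintegralD//.
  by apply: eq_Rintegral => x _; rewrite (wlap_split T) mulrDr.
apply: (le_trans (le_normr_Rintegral measurableT iFK)).
rewrite -RintegralZl//; last exact: integrable_norm iF.
apply: le_Rintegral => //.
- exact: integrable_norm iFK.
- have := integrableZl measurableT (B T) (integrable_norm iF).
  by apply: eq_integrable.
- by move=> x _; rewrite normrM mulrC ler_wpM2r.
Qed.

End LaplaceBound.

(** * Dilation of Lebesgue measure and vanishing primitives *)

Section Half.
Context {R : realType}.
Notation mu := (@lebesgue_measure R).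

Let half : measurableTypeR R -> measurableTypeR R := fun x : R => x / 2.

Let mhalf : measurable_fun setT half.
Proof. by apply: measurable_funM. Qed.

#[local] HB.instance Definition _ := @isMeasurableFun.Build _ _ _ _ half mhalf.

Let half_nng : {nonneg R} := (2^-1)%:nng.

(** Half of the image measure under [half] agrees with Lebesgue measure on half-open intervals, and
    uniqueness extends this to all measurable sets. *)
Lemma ge0_integral_half (h : R -> \bar R) : measurable_fun setT h ->
  (forall x, 0 <= h x)%E ->
  (\int[mu]_x h (x / 2)%R = 2%:E * \int[mu]_x h x)%E.
Proof.
move=> mh h0.
have E : (\int[mu]_x h x = (2^-1)%:E * \int[mu]_x h (x / 2)%R)%E.
  rewrite -[X in (_ * X)%E]/(\int[mu]_(x in half @^-1` setT) (h \o half) x)%E.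
  rewrite -(@ge0_integral_pushforward _ _ _ _ _ _ mhalf mu)//.
  rewrite -(ge0_integral_mscale _ _ half_nng)//.
  apply: eq_measure_integral => //= A mA _.
  apply: lebesgue_measure_unique => // _ [[a b]] _ <- /=.
  rewrite /mscale/= /pushforward.
  rewrite (_ : half @^-1` _ = `]a * 2, b * 2]%classic); last first.
    by apply/seteqP; split => x /=; rewrite !in_itv/= /half ltr_pdivlMr// ler_pdivrMr.
  rewrite !lebesgue_measure_itv/= !lte_fin ltr_pM2r//.
  case: ifPn => _; last by rewrite mule0.
  by rewrite -!EFinD -EFinM -mulNr -mulrDl mulrCA mulVf// mulr1.
by rewrite E muleA -EFinM divff// mul1e.
Qed.

Lemma integrable_half (g : R -> R) : mu.-integrable setT (EFin \o g) ->
  mu.-integrable setT (EFin \o (fun x => g (x / 2))).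
Proof.
move=> /integrableP[mg gy]; apply/integrableP; split.
  exact: (measurableT_comp mg mhalf).
rewrite (@ge0_integral_half (fun x => `|(EFin \o g) x|)%E)//.
  by apply: lte_mul_pinfty.
exact: measurableT_comp.
Qed.

Lemma Rintegral_half (g : R -> R) : mu.-integrable setT (EFin \o g) ->
  \int[mu]_x (g (x / 2) / 2) = \int[mu]_x g x.
Proof.
move=> ig; have mg := measurable_int _ ig.
have mP : measurable_fun setT (EFin \o g)^\+%E by exact: measurable_funepos.
have mN : measurable_fun setT (EFin \o g)^\-%E by exact: measurable_funeneg.
have E : \int[mu]_x g (x / 2) = 2 * \int[mu]_x g x; last first.
  rewrite RintegralZr//; last exact: integrable_half.
  by rewrite E mulrAC divff ?mul1r.
rewrite /Rintegral integralE [in RHS]integralE.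
transitivity (fine (2%:E * \int[mu]_x (EFin \o g)^\+ x -
    2%:E * \int[mu]_x (EFin \o g)^\- x)%E).
  congr (fine (_ - _)%E).
    rewrite -(ge0_integral_half mP); last by move=> x; exact: funepos_ge0.
    by apply: eq_integral => x _; rewrite !funeposE.
  rewrite -(ge0_integral_half mN); last by move=> x; exact: funeneg_ge0.
  by apply: eq_integral => x _; rewrite !funenegE.
rewrite -muleBr//; last first.
  apply: fin_num_adde_defr; exact: integrable_pos_fin_num.
apply: fineM => //.
by rewrite -integralE; exact: integrable_fin_num.
Qed.

End Half.

Section Primitive.
Context {R : realType}.
Notation mu := (@lebesgue_measure R).

(** Lebesgue differentiation recovers [g] almost everywhere as the derivative of its primitive, and
    that primitive is constant near each point of the open set [U]. *)
Lemma ae_eq0_of_primitive (g : R -> R) (U : set R) (c : R) :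
  measurable_fun setT g ->
  (forall y, mu.-integrable `]-oo, y] (EFin \o g)) -> open U ->
  (forall y, U y -> \int[mu]_(x in `]-oo, y]) g x = c) ->
  {ae mu, forall x, U x -> g x = 0}.
Proof.
move=> mg ig oU Uc.
have lg : locally_integrable setT g.
  split=> //; first exact: openT.
  move=> K _ cK; have [M [_ KM]] := compact_bounded cK.
  have [/integrableP[_]] := ig (M + 1); apply: le_lt_trans.
  apply: ge0_subset_integral => //.
  - exact: compact_measurable.
  - by apply/measurable_EFinP; apply: measurableT_comp => //; exact: measurable_funTS.
  - move=> x Kx /=; rewrite in_itv/= (le_trans (ler_norm x))//.
    by apply: (KM (M + 1)) => //; rewrite ltrDl.
have := FTC1Ny ig lg; apply: filterS; first exact: (ae_filter_ringOfSetsType mu).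
move=> x [dG <-] Ux; rewrite derive1E.
have [//] : is_derive x 1 (fun y => \int[mu]_(t in `]-oo, y]) g t) 0.
apply: (@near_eq_is_derive _ _ _ (cst c)).
have : nbhs x U by exact: open_nbhs_nbhs.
by apply: filterS => y /Uc.
Qed.

End Primitive.

(** * Vanishing of the data *)

Section Data.
Context {R : realType}.
Notation mu := (@lebesgue_measure R).
Implicit Types f g : R -> R.

(** For each [s] the inner integral ignores null sets. This permits replacing almost-everywhere
    support conditions by pointwise ones. *)
Lemma eq_Va_ae a T f g y : measurable_fun setT f -> measurable_fun setT g ->
  {ae mu, forall x, f x = g x} -> Va a T f y = Va a T g y.
Proof.
move=> mf mg fg; apply: eq_Rintegral => s _; rewrite /Ua /Rintegral; congr fine.
have mh (h : R -> R) : measurable_fun setT h ->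
    measurable_fun setT (fun x : R => (Ka a (T - s) (y - x) * (wa a s x * h x))%:E).
  move=> mh; apply/measurable_EFinP; apply: measurable_funM.
    by apply: measurable_Ka_comp => //; exact: measurable_funB.
  by apply: measurable_funM => //; exact: (measurable_fun_pair2 s (measurable_wa a)).
apply: ae_eq_integral; [exact: measurableT|exact: mh|exact: mh|].
by move: fg; apply: filterS; [exact: (ae_filter_ringOfSetsType mu)|move=> x -> _].
Qed.

Lemma integrable_expR_ge (L k : R) : 0 < k ->
  mu.-integrable setT (EFin \o (fun x => expR (- (k * x)) * (- L <= x)%R%:R)).
Proof.
move=> k0; have mb : measurable_fun setT (fun x : R => (- L <= x)%R%:R : R).
  by apply: (measurableT_comp (f := fun b : bool => b%:R : R)) => //; exact: measurable_fun_ler.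
apply/integrableP; split.
  apply/measurable_EFinP; apply: measurable_funM => //.
  by apply: measurableT_comp => //; apply: measurableT_comp => //; exact: measurable_funM.
under eq_integral => x _ do rewrite /= ger0_norm ?mulr_ge0 ?expR_ge0//.
rewrite integral_mulb (_ : [set x | - L <= x] = `[- L, +oo[%classic); last first.
  by apply/seteqP; split => z /=; rewrite in_itv/= andbT.
have E (x : R) : expR (- (k * x)) = expR ((- k) * x + 0) by congr expR; ring.
under eq_integral => x _ do rewrite E.
by rewrite integral_expR_itvcy ?oppr_lt0// ltry.
Qed.

(** By |f| <= 1 + f^2 it suffices that the weight be integrable on the support, for the term 1, and
    bounded there by [expR (k * L)], for the term f^2. *)
Lemma L2_integrable_expR f (L k : R) : L2 f -> (forall x, x < - L -> f x = 0) ->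
  0 < k -> mu.-integrable setT (EFin \o (fun x => f x * expR (- (k * x)))).
Proof.
move=> [mf f2] fL k0.
have i2 : mu.-integrable setT (EFin \o (fun x => f x ^+ 2)).
  apply/integrableP; split; first by apply/measurable_EFinP; exact: measurable_funX.
  by under eq_integral => x _ do rewrite /= ger0_norm ?sqr_ge0//.
pose h x := expR (- (k * x)) * (- L <= x)%R%:R + expR (k * L) * f x ^+ 2.
have ih : mu.-integrable setT (EFin \o h).
  have := integrableD measurableT (integrable_expR_ge L k0)
    (integrableZl measurableT (expR (k * L)) i2).
  by apply: eq_integrable.
apply: le_integrable ih => //.
  apply/measurable_EFinP; apply: measurable_funM => //.
  by apply: measurableT_comp => //; apply: measurableT_comp => //; exact: measurable_funM.
move=> x _; rewrite /= lee_fin /h normrM (ger0_norm (expR_ge0 _)).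
rewrite [leRHS]ger0_norm; last first.
  by apply: addr_ge0; apply: mulr_ge0; rewrite ?expR_ge0 ?sqr_ge0.
have [xL|Lx] := ltP x (- L).
  by rewrite fL// normr0 mul0r expr0n/= !mulr0 addr0.
rewrite mulr1; apply: (@le_trans _ _ ((1 + f x ^+ 2) * expR (- (k * x)))).
  rewrite ler_wpM2r ?expR_ge0// -(real_normK (num_real (f x))).
  by have := sqr_ge0 (`|f x| - 1); have := normr_ge0 (f x); nra.
rewrite mulrDl mul1r lerD2l mulrC ler_wpM2r ?sqr_ge0// ler_expR.
by rewrite -mulrN ler_wpM2l ?(ltW k0)//; lra.
Qed.

(** In the variable [- 2 * x], nonnegative on the support, [lerch] applies without point mass. It
    controls the mass of [f] on right half-lines; that the total mass is 0 converts this into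
    primitives from the left. *)
Lemma Va_inj_negative (a T L : R) f : 0 < T -> measurable_fun setT f ->
  mu.-integrable setT (EFin \o f) ->
  (forall x, x < - L -> f x = 0) -> (forall x, 0 < x -> f x = 0) ->
  {ae mu, forall y, Va a T f y = 0} ->
  {ae mu, forall x, x < 0 -> f x = 0}.
Proof.
move=> T0 mf intf fL f0 V0.
(* The factor 2 ensures [2 * a <= p], that is [p / (p - a) <= 2], whence the constant 4 in
   [small]. *)
pose p0 := 2 * `|a| + 1.
have na : 0 <= `|a| by [].
have p0_gt0 : 0 < p0 by rewrite /p0; lra.
have bnd p : p0 <= p -> [/\ 0 < p, `|a| < p, 0 < p - a, 0 < p + a & 2 * a <= p].
  rewrite /p0 => pp; have := ler_norm a; have := ler_norm (- a); rewrite normrN.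
  by move=> ? ?; split; lra.
have e_le1 k x : 0 <= k -> `|f x * expR (k * x)| <= `|f x|.
  move=> k0; have [x0|x0] := ltP 0 x; first by rewrite f0// mul0r.
  rewrite normrM (ger0_norm (expR_ge0 _)) ler_piMr//.
  by rewrite -expR0 ler_expR mulr_ge0_le0.
have ie k : 0 <= k -> mu.-integrable setT (EFin \o (fun x => f x * expR (k * x))).
  move=> k0; apply: le_integrable intf => //.
    apply/measurable_EFinP; apply: measurable_funM => //.
    by apply: measurableT_comp => //; exact: measurable_funM.
  by move=> x _; rewrite /= lee_fin; exact: e_le1.
pose D := \int[mu]_x `|f x|.
have small p : p0 <= p ->
    `|0 + \int[mu]_x (f x * expR (- (p * (- 2 * x))))| <=
    4 * expR (a ^+ 2 * T) * D * expR (0 * p - T * p ^+ 2).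
  move=> pp; have [pg ap pma pa ap2] := bnd _ pp.
  have ipm := ie (p - a) (ltW pma).
  have := Va_eq0_bound ap T0 mf erefl ipm V0.
  rewrite (_ : \int[mu]_x (f x * expR ((p - a) * x) * wlap a p x) =
    (2 * p * (p + a))^-1 * \int[mu]_x (f x * expR (- (p * (- 2 * x))))); last first.
    rewrite -RintegralZl//; last first.
      have := ie (2 * p) (mulr_ge0 (ler0n R 2) (ltW pg)).
      apply: eq_integrable => // x _ /=; congr (_ * expR _)%:E; ring.
    apply: eq_Rintegral => x _; rewrite /wlap; case: leP => x0; last first.
      by rewrite f0// !mul0r mulr0.
    rewrite (_ : - (p * (- 2 * x)) = (p - a) * x + (a + p) * x); last by ring.
    by rewrite expRD; ring.
  rewrite normrM ger0_norm ?invr_ge0 ?mulr_ge0 ?(ltW pa) ?(ltW pg)// add0r.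
  rewrite ler_pdivrMl ?mulr_gt0// => /le_trans; apply.
  have q0 : 0 < p ^+ 2 - a ^+ 2.
    by rewrite (_ : _ - _ = (p - a) * (p + a)) ?mulr_gt0//; ring.
  rewrite (_ : 4 * _ * D * _ =
    2 * p * (p + a) * (expR (- ((p ^+ 2 - a ^+ 2) * T)) / (p ^+ 2 - a ^+ 2) *
     (2 * (p - a) / p * D))); last first.
    rewrite (_ : - ((p ^+ 2 - a ^+ 2) * T) = a ^+ 2 * T + (0 * p - T * p ^+ 2)); last by ring.
    rewrite (expRD (a ^+ 2 * T)) (_ : p ^+ 2 - a ^+ 2 = (p - a) * (p + a)); last by ring.
    by field; rewrite !gt_eqF.
  rewrite ler_wpM2l ?mulr_ge0 ?(ltW pa) ?(ltW pg)//.
  rewrite ler_wpM2l ?mulr_ge0 ?expR_ge0 ?invr_ge0 ?(ltW q0)//.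
  have D0 : 0 <= D by apply: Rintegral_ge0.
  apply: (@le_trans _ _ D).
    apply: le_Rintegral => //; [exact: integrable_norm ipm|exact: integrable_norm intf|].
    by move=> x _; apply: e_le1; exact: ltW.
  by rewrite -[leLHS]mul1r ler_wpM2r// ler_pdivlMr// mul1r; lra.
have LE t : 0 < t -> \int[mu]_(x in [set x | - 2 * x <= t]) f x = 0.
  move=> t0; rewrite -[LHS]add0r.
  apply: (@lerch _ _ R mu f (fun x => - 2 * x) 0 p0 0 T _ t _ _ p0_gt0 T0 _ _ small t0) => //.
  - exact: measurable_funM.
  - move=> x; apply: contraR; rewrite -ltNge => x0; apply/eqP/f0; lra.
  - move=> p pp; have [pg _ _ _ _] := bnd _ pp.
    have := ie (2 * p) (mulr_ge0 (ler0n R 2) (ltW pg)).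
    by apply: eq_integrable => // x _ /=; congr (_ * expR _)%:E; ring.
  - have -> : [set x : R | - 2 * x = t] = [set - t / 2].
      by apply/seteqP; split => x /=; lra.
    exact: lebesgue_measure_set1.
apply: (@ae_eq0_of_primitive R f [set y : R | y < 0] 0) => //.
- by move=> y; apply: integrableS intf.
move=> y /= y0.
have S t : [set x : R | - 2 * x <= t] = `[- (t / 2), +oo[%classic.
  by apply/seteqP; split => x /=; rewrite in_itv/= andbT; lra.
have tot : \int[mu]_x f x = 0.
  (* For this [t] the half-line [x >= - t / 2] contains the whole support. *)
  have t0 : 0 < 2 * `|L| + 1 by have := normr_ge0 L; lra.
  rewrite -(LE _ t0) [RHS]Rintegral_mkcond; apply: eq_Rintegral => x _.
  rewrite patchE; case: ifPn => //; rewrite notin_setE/= => /negP; rewrite -ltNge => xL.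
  by apply: fL; have := ler_norm L; lra.
have up : \int[mu]_(x in `]y, +oo[) f x = 0.
  have t0 : 0 < - 2 * y by lra.
  rewrite Rintegral_itv_obnd_cbnd; last by apply: integrableS intf.
  by rewrite -(LE _ t0) S (_ : - (- 2 * y / 2) = y)//; lra.
rewrite -tot -(itv_setU_setT false y) Rintegral_setU//.
- by rewrite up addr0.
- by rewrite itv_setU_setT.
- apply/disj_setPS => z /= []; rewrite !in_itv/= andbT => zy.
  by rewrite ltNge zy.
Qed.

End Data.

(** * The positive half-line: from the transform to a functional equation *)

Section Positive.
Context {R : realType}.
Notation mu := (@lebesgue_measure R).
Variables (a T L : R) (f : R -> R).
Hypotheses (T_gt0 : 0 < T) (mf : measurable_fun setT f).
Hypothesis fL : forall x, x < - L -> f x = 0.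
Hypothesis intf : forall k, 0 < k ->
  mu.-integrable setT (EFin \o (fun x => f x * expR (- (k * x)))).
Hypothesis V0 : {ae mu, forall y, Va a T f y = 0}.

Let pos (x : R) : R := (0 < x)%R%:R.
Let neg (x : R) : R := (x <= 0)%R%:R.
Let A := \int[mu]_x (f x * neg x).
(* [E p x] is [p] times the Laplace transform in [u > 0] of the indicator of [x <= u / 2]. *)
Let E (p x : R) := expR (- (p * Num.max 0 (2 * x))).
Let G (u : R) := \int[mu]_x (f x * (x <= u / 2)%R%:R).
(** The inverse transform, term by term, of [wlapE] integrated against [f]: the exponential of rate
    [p + a] corresponds to [u = x], that of rate [2 * p] to [u = 2 * x], and the factor 1/p before
    [E] is an integration in [u], which produces [G]. The term [neg], free of [p], is the point mass
    [A] left outside. *)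
Let g (u : R) := pos u * (2 * (expR (- (a * u)) * f u)) - pos u * (f (u / 2) / 2)
  - a * (pos u * G u).

Let mbool (P : R -> bool) : measurable_fun setT P ->
  measurable_fun setT (fun x => (P x)%:R : R).
Proof. by move=> mP; apply: (measurableT_comp (f := fun b : bool => b%:R : R)). Qed.

Let mpos : measurable_fun setT pos.
Proof. by apply: mbool; apply: measurable_fun_ltr. Qed.

Let mneg : measurable_fun setT neg.
Proof. by apply: mbool; apply: measurable_fun_ler. Qed.

Let mE p : measurable_fun setT (E p).
Proof.
apply: measurableT_comp => //; apply: measurableT_comp => //.
by apply: measurable_funM => //; apply: measurable_maxr => //; exact: measurable_funM.
Qed.

Let E_ge0 p x : 0 <= E p x. Proof. exact: expR_ge0. Qed.

Let dom (w : R -> R) (k c : R) : 0 < k -> measurable_fun setT w ->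
  (forall x, `|w x| <= c * expR (- (k * x))) ->
  mu.-integrable setT (EFin \o (fun x => f x * w x)).
Proof.
move=> k0 mw wk.
apply: (@le_integrable _ _ _ mu _ measurableT _ (fun x => (c%:E * (f x * expR (- (k * x)))%:E)%E)).
- by apply/measurable_EFinP; exact: measurable_funM.
- move=> x _; rewrite /= lee_fin normrM.
  have c0 : 0 <= c * expR (- (k * x)) := le_trans (normr_ge0 _) (wk x).
  by rewrite mulrCA normrM ler_wpM2l// (ger0_norm c0).
- exact: integrableZl (intf k0).
Qed.

Let E_le p x : 0 < p -> `|E p x| <= 1 * expR (- (p * x)).
Proof.
move=> p0; rewrite mul1r ger0_norm// ler_expR lerN2 ler_wpM2l ?(ltW p0)//.
by rewrite le_max; case: (ltP x 0) => x0; [rewrite (ltW x0)|apply/orP; right; lra].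
Qed.

Let intfE p : 0 < p -> mu.-integrable setT (EFin \o (fun x => f x * E p x)).
Proof. by move=> p0; apply: (dom p0 (mE p)) => x; exact: E_le. Qed.

Let neg_le k x : 0 < k -> `|neg x| <= 1 * expR (- (k * x)).
Proof.
move=> k0; rewrite mul1r /neg ger0_norm//; case: (leP x 0) => x0 /=; last by rewrite mulr0n expR_ge0.
by rewrite mulr1n -expR0 ler_expR oppr_ge0 mulr_ge0_le0// ltW.
Qed.

Let int_neg : mu.-integrable setT (EFin \o (fun x => f x * neg x)).
Proof. by apply: (@dom neg 1 1) => // x; exact: neg_le. Qed.

Let intpos k : 0 < k ->
  mu.-integrable setT (EFin \o (fun x => f x * (pos x * expR (- (k * x))))).
Proof.
move=> k0; apply: (@dom _ k 1) => //.
  apply: measurable_funM => //; apply: measurableT_comp => //.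
  by apply: measurableT_comp => //; exact: measurable_funM.
move=> x; rewrite normrM (ger0_norm (expR_ge0 _)) ler_wpM2r ?expR_ge0//.
by rewrite /pos ger0_norm// lern1 leq_b1.
Qed.

(** The prefactor clears the denominators of [wlap] up to one 1/p. The leftover quotients (p - a)/p
    for x <= 0 and (p + a)/p for x > 0 split into 1 and a/p, and both a/p parts merge into the
    single term in [E]. *)
Let wlapE p x : `|a| < p ->
  2 * (p ^+ 2 - a ^+ 2) * (expR ((- p - a) * x) * wlap a p x) =
  neg x + pos x * (2 * expR (- ((p + a) * x))) - pos x * expR (- (2 * p * x))
  - a / p * E p x.
Proof.
rewrite ltr_norml => /andP[pa ap].
have p0 : p != 0 by lra.
have pa0 : p + a != 0 by lra.
have pma0 : p - a != 0 by lra.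
have q : p ^+ 2 - a ^+ 2 = (p - a) * (p + a) by ring.
rewrite /wlap /neg /pos /E; case: (leP x 0) => x0 /=.
  rewrite max_l; last by lra.
  rewrite mulr0 oppr0 expR0 q !mul0r addr0 subr0 mulr1.
  rewrite mulrA -expRD (_ : (- p - a) * x + (a + p) * x = 0); last by ring.
  by rewrite expR0; field; rewrite p0 pa0.
rewrite max_r; last by lra.
rewrite (_ : p * (2 * x) = 2 * p * x); last by ring.
have E2 : expR (- (2 * p * x)) = expR ((- p - a) * x) * expR ((a - p) * x).
  by rewrite -expRD; congr expR; ring.
rewrite E2 (_ : - ((p + a) * x) = (- p - a) * x) ?q; last by ring.
by field; rewrite p0 pa0 pma0.
Qed.

Let int_cut v : mu.-integrable setT (EFin \o (fun x => f x * (x <= v)%R%:R)).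
Proof.
apply: (@dom _ 1 (expR v)) => //; first by apply: mbool; apply: measurable_fun_ler.
move=> x; rewrite ger0_norm// mul1r -expRD; case: (leP x v) => xv /=.
  by rewrite -[leLHS]expR0 ler_expR subr_ge0.
exact: expR_ge0.
Qed.

Let k (p : R) (w : R * R) := (pos w.1 * expR (- (p * w.1))) * (f w.2 * (w.2 <= w.1 / 2)%R%:R).

Let mk p : measurable_fun setT (k p).
Proof.
apply: measurable_funM; apply: measurable_funM.
- exact: measurableT_comp.
- by apply: measurableT_comp => //; apply: measurableT_comp => //; exact: measurable_funM.
- exact: measurableT_comp.
- apply: (measurableT_comp (f := fun b : bool => b%:R : R)) => //.
  by apply: measurable_fun_ler => //; exact: measurable_funM.
Qed.

Let int_u p x : 0 < p ->
  (\int[mu]_u (pos u * expR (- (p * u)) * (x <= u / 2)%R%:R)%:E = (p^-1 * E p x)%:E)%E.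
Proof.
move=> p_gt0; pose M := Num.max 0 (2 * x).
transitivity (\int[mu]_(u in `[M, +oo[) (expR (- p * u + 0))%:E)%E; last first.
  rewrite integral_expR_itvcy ?oppr_lt0// addr0 invrN mulNr opprK /E.
  by congr (_ * expR _)%:E; rewrite mulNr.
have eq_int u : (pos u * expR (- (p * u)) * (x <= u / 2)%R%:R =
    expR (- p * u + 0) * ((0 < u) && (2 * x <= u))%R%:R)%R.
  rewrite addr0 mulNr ler_pdivlMr// [x * 2]mulrC /pos.
  by case: (0 < u)%R; rewrite ?mul0r ?mulr0//= mul1r.
under eq_integral do rewrite eq_int.
rewrite integral_mulb /M; case: (ltP 0 (2 * x)) => x0.
  rewrite (_ : [set u : R | (0 < u)%R && (2 * x <= u)%R] = `[2 * x, +oo[%classic)//.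
  apply/seteqP; split => u /=; rewrite in_itv/= andbT; first by move=> /andP[].
  by move=> xu; rewrite xu (lt_le_trans x0 xu).
rewrite (_ : [set u : R | (0 < u)%R && (2 * x <= u)%R] = `]0%R, +oo[%classic); last first.
  apply/seteqP; split => u /=; rewrite in_itv/= andbT; first by move=> /andP[].
  by move=> u0; rewrite u0 (le_trans x0 (ltW u0)).
rewrite integral_itv_obnd_cbnd//; apply/measurable_EFinP; apply: measurable_funTS.
by apply: measurableT_comp => //; apply: measurable_funD => //; exact: measurable_funM.
Qed.

Let int_k p : 0 < p -> (mu \x mu)%E.-integrable setT (EFin \o k p).
Proof.
move=> p_gt0; apply: (integrable21ltyP _ _ _).2; first by apply/measurable_EFinP; exact: mk.
have /integrableP[_] := integrableZl measurableT p^-1 (intfE p_gt0).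
apply: le_lt_trans; rewrite le_eqVlt; apply/orP; left; apply/eqP.
apply: eq_integral => x _.
transitivity (\int[mu]_u (`|f x|%:E *
    (pos u * expR (- (p * u)) * (x <= u / 2)%R%:R)%:E))%E.
  apply: eq_integral => u _; rewrite /= -EFinM /k/= !normrM /pos.
  rewrite (ger0_norm (ler0n _ (0 < u)%R)) (ger0_norm (ler0n _ (x <= u / 2)%R)).
  by rewrite (ger0_norm (expR_ge0 _)); congr EFin; ring.
rewrite ge0_integralZl//.
- rewrite int_u// -!EFinM /= !normrM (ger0_norm (E_ge0 _ _)).
  by rewrite ger0_norm ?invr_ge0 ?(ltW p_gt0)//; congr EFin; ring.
- apply/measurable_EFinP; apply: measurable_funM.
    apply: measurable_funM => //; apply: measurableT_comp => //.
    by apply: measurableT_comp => //; exact: measurable_funM.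
  by apply: mbool; apply: measurable_fun_ler => //; exact: measurable_funM.
- by move=> u _; rewrite lee_fin /pos !mulr_ge0 ?expR_ge0.
Qed.

Let k_x p u : \int[mu]_x k p (u, x) = pos u * G u * expR (- (p * u)).
Proof. by rewrite /k/= RintegralZl// -/(G u); ring. Qed.

Let k_u p x : 0 < p -> \int[mu]_u k p (u, x) = p^-1 * (f x * E p x).
Proof.
move=> p_gt0; pose q u := pos u * expR (- (p * u)) * (x <= u / 2)%R%:R.
have mq : measurable_fun setT q.
  apply: measurable_funM.
    apply: measurable_funM => //; apply: measurableT_comp => //.
    by apply: measurableT_comp => //; exact: measurable_funM.
  by apply: mbool; apply: measurable_fun_ler => //; exact: measurable_funM.
have iq : mu.-integrable setT (EFin \o q).
  apply/integrableP; split; first exact/measurable_EFinP.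
  under eq_integral => u _ do rewrite /= ger0_norm ?mulr_ge0 ?expR_ge0 ?ler0n//.
  by rewrite int_u// ltry.
transitivity (\int[mu]_u (f x * q u)); first by apply: eq_Rintegral => u _; rewrite /k/q/=; ring.
by rewrite RintegralZl// /Rintegral int_u//=; ring.
Qed.

Let laplace_G p : 0 < p ->
  mu.-integrable setT (EFin \o (fun u => pos u * G u * expR (- (p * u)))) /\
  \int[mu]_u (pos u * G u * expR (- (p * u))) = p^-1 * \int[mu]_x (f x * E p x).
Proof.
move=> p_gt0; split.
  rewrite (_ : EFin \o _ = fubini_F mu (EFin \o k p)).
    exact: integrable_fubini_F (int_k p_gt0).
  apply/funext => u; rewrite /= -k_x /Rintegral /fubini_F fineK//.
  apply: integrable_fin_num => //.
  have := integrableZl measurableT (pos u * expR (- (p * u))) (int_cut (u / 2)).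
  by apply: eq_integrable.
under eq_Rintegral do rewrite -k_x.
rewrite (Rintegral12_prod_meas (int_k p_gt0)) -(Rintegral21_prod_meas (int_k p_gt0)).
under eq_Rintegral do rewrite k_u//.
by rewrite RintegralZl//; exact: intfE.
Qed.

(** Fubini already gives measurability of the weighted function at [p = 1]; the weight is then
    undone. *)
Let mpG : measurable_fun setT (fun u => pos u * G u).
Proof.
rewrite (_ : (fun u => _) = fun u => pos u * G u * expR (- (1 * u)) * expR u).
  apply: measurable_funM => //.
  by have [/integrableP[/measurable_EFinP]] := laplace_G ltr01.
by apply/funext => u; rewrite -mulrA -expRD mul1r addNr expR0 mulr1.
Qed.

Let p0 : R := `|a| + 1.

Let p0P p : p0 <= p -> [/\ 0 < p, `|a| < p, 0 < p + a & 0 < p - a].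
Proof.
rewrite /p0 => pp; have := ler_norm a; have := ler_norm (- a); rewrite normrN.
by have := normr_ge0 a => ? ? ?; split; lra.
Qed.

Let g1 (p u : R) := f u * (pos u * (2 * expR (- ((p + a) * u)))).
Let h2 (p x : R) := f x * (pos x * expR (- (2 * p * x))).

Let int1 p : p0 <= p -> mu.-integrable setT (EFin \o g1 p).
Proof.
move=> /p0P[_ _ pa _]; have := integrableZl measurableT 2 (intpos pa).
by apply: eq_integrable => // x _; rewrite /= -EFinM /g1; congr EFin; ring.
Qed.

Let int2 p : p0 <= p -> mu.-integrable setT (EFin \o h2 p).
Proof. by move=> /p0P[p_gt0 _ _ _]; apply: intpos; rewrite mulr_gt0. Qed.

Let g_split p u : g u * expR (- (p * u)) =
  g1 p u - h2 p (u / 2) / 2 - a * (pos u * G u * expR (- (p * u))).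
Proof.
rewrite /g /g1 /h2 !mulrBl; congr (_ - _ - _); last by ring.
  rewrite (_ : - ((p + a) * u) = - (a * u) + - (p * u)); last by ring.
  by rewrite expRD; ring.
have -> : pos (u / 2) = pos u by rewrite /pos pmulr_lgt0 ?invr_gt0.
by rewrite (_ : 2 * p * (u / 2) = p * u); [ring|field].
Qed.

Let int2h p : p0 <= p -> mu.-integrable setT (EFin \o (fun u => h2 p (u / 2) / 2)).
Proof.
move=> /int2/integrable_half/(integrableZl measurableT 2^-1).
by apply: eq_integrable => // x _; rewrite /= -EFinM mulrC.
Qed.

Let intg p : p0 <= p -> mu.-integrable setT (EFin \o (fun u => g u * expR (- (p * u)))).
Proof.
move=> pp; have [p_gt0 _ _ _] := p0P pp; have [iG _] := laplace_G p_gt0.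
have := integrableB measurableT (integrableB measurableT (int1 pp) (int2h pp))
  (integrableZl measurableT a iG).
by apply: eq_integrable => // u _; rewrite /= g_split.
Qed.

Let laplace_g p : p0 <= p -> A + \int[mu]_u (g u * expR (- (p * u))) =
  2 * (p ^+ 2 - a ^+ 2) * \int[mu]_x (f x * expR ((- p - a) * x) * wlap a p x).
Proof.
move=> pp; have [p_gt0 ap _ _] := p0P pp; have [iG EG] := laplace_G p_gt0.
have i12 : mu.-integrable setT (EFin \o (fun u => g1 p u - h2 p (u / 2) / 2)).
  have := integrableB measurableT (int1 pp) (int2h pp).
  by apply: eq_integrable.
have iaG : mu.-integrable setT (EFin \o (fun u => a * (pos u * G u * expR (- (p * u))))).
  have := integrableZl measurableT a iG; by apply: eq_integrable.
under eq_Rintegral do rewrite g_split.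
rewrite RintegralB// RintegralB//; [|exact: int1|exact: int2h].
rewrite RintegralZl// EG (Rintegral_half (int2 pp)).
have inA : mu.-integrable setT (EFin \o (fun x => f x * neg x + g1 p x)).
  have := integrableD measurableT int_neg (int1 pp); by apply: eq_integrable.
have inB : mu.-integrable setT (EFin \o (fun x => f x * neg x + g1 p x - h2 p x)).
  have := integrableB measurableT inA (int2 pp); by apply: eq_integrable.
have ifE := intfE p_gt0.
have iaE : mu.-integrable setT (EFin \o (fun x => a / p * (f x * E p x))).
  have := integrableZl measurableT (a / p) ifE; by apply: eq_integrable.
transitivity (\int[mu]_x (f x * neg x + g1 p x - h2 p x - a / p * (f x * E p x))).
  rewrite RintegralB// RintegralB//; last exact: int2.
  rewrite RintegralD//; last exact: int1.
  by rewrite RintegralZl// -/A; ring.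
rewrite -RintegralZl//; last first.
  apply: integrable_mul_wlap => //.
  have [_ _ pa _] := p0P pp; have := intf pa.
  by apply: eq_integrable => // x _ /=; congr (_ * expR _)%:E; ring.
apply: eq_Rintegral => x _.
transitivity (f x * (2 * (p ^+ 2 - a ^+ 2) * (expR ((- p - a) * x) * wlap a p x))).
  by rewrite wlapE// /g1 /h2; ring.
by ring.
Qed.

Let D := \int[mu]_x `|f x * expR (- ((p0 + a) * x))|.

(** On [x >= - L], the weight at [p] is at most [expR ((p - p0) * L)] times the weight at [p0]. The
    norm of [f] is therefore measured once, in [D], and the support bound [L] becomes the rate [b]
    of [lerch]. *)
Let small p : p0 <= p -> `|A + \int[mu]_u (g u * expR (- (p * u)))| <=
  2 * D * expR (a ^+ 2 * T - p0 * L) * expR (L * p - T * p ^+ 2).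
Proof.
move=> pp; have [p_gt0 ap pa pma] := p0P pp; have [_ _ p0a _] := p0P (lexx p0).
rewrite laplace_g//.
have q0 : 0 < p ^+ 2 - a ^+ 2.
  by rewrite (_ : _ - _ = (p - a) * (p + a)) ?mulr_gt0//; ring.
have ipm : mu.-integrable setT (EFin \o (fun x => f x * expR ((- p - a) * x))).
  have := intf pa.
  by apply: eq_integrable => // x _ /=; congr (_ * expR _)%:E; ring.
have := Va_eq0_bound ap T_gt0 mf (sqrrN p) ipm V0.
have c0 : 0 <= 2 * (p ^+ 2 - a ^+ 2) by rewrite mulr_ge0 ?(ltW q0).
rewrite normrM (ger0_norm c0) => H; apply: (le_trans (ler_wpM2l c0 H)).
have DL : \int[mu]_x `|f x * expR ((- p - a) * x)| <= expR ((p - p0) * L) * D.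
  rewrite -RintegralZl//; last exact: integrable_norm (intf p0a).
  apply: le_Rintegral => //; first exact: integrable_norm ipm.
    have := integrableZl measurableT (expR ((p - p0) * L)) (integrable_norm (intf p0a)).
    by apply: eq_integrable.
  move=> x _; have [xL|Lx] := ltP x (- L).
    by rewrite fL// !mul0r normr0 mulr0.
  rewrite !normrM mulrCA ler_wpM2l// !(ger0_norm (expR_ge0 _)) -expRD ler_expR.
  have : 0 <= (p - p0) * (x + L) by rewrite mulr_ge0 ?subr_ge0//; lra.
  lra.
rewrite mulrA (_ : 2 * (p ^+ 2 - a ^+ 2) * _ = 2 * expR (- ((p ^+ 2 - a ^+ 2) * T))); last first.
  by field; rewrite gt_eqF.
apply: (le_trans (ler_wpM2l _ DL)); first by rewrite mulr_ge0 ?expR_ge0.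
have EE : expR (a ^+ 2 * T - p0 * L) * expR (L * p - T * p ^+ 2) =
    expR (- ((p ^+ 2 - a ^+ 2) * T)) * expR ((p - p0) * L).
  by rewrite -!expRD; congr expR; ring.
rewrite le_eqVlt; apply/orP; left; apply/eqP.
by rewrite -[RHS]mulrA EE; ring.
Qed.

Let mg : measurable_fun setT g.
Proof.
apply: measurable_funB.
  apply: measurable_funB; apply: measurable_funM => //.
    apply: measurable_funM => //; apply: measurable_funM => //.
    by apply: measurableT_comp => //; apply: measurableT_comp => //; exact: measurable_funM.
  apply: measurable_funM => //; apply: measurableT_comp => //.
  exact: measurable_funM.
by apply: measurable_funM => //; exact: mpG.
Qed.

Let prim_g t : 0 < t -> \int[mu]_(u in `]-oo, t]) g u = - A.
Proof.
move=> t0; apply/eqP; rewrite -addr_eq0 addrC; apply/eqP.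
have p0_gt0 : 0 < p0 by have [] := p0P (lexx p0).
have := @lerch _ _ R mu g id A p0 L T _ t mg (@measurable_id _ _ _) p0_gt0 T_gt0 _ intg small t0.
rewrite (_ : [set x : R | id x <= t] = `]-oo, t]%classic); last first.
  by apply/seteqP; split => x /=; rewrite in_itv.
apply.
- move=> x; apply: contraR; rewrite -ltNge => x0.
  by rewrite /g /pos ltNge (ltW x0) !mul0r mulr0 !subr0.
- exact: lebesgue_measure_set1.
Qed.

Let ae_g_eq0 : {ae mu, forall u, 0 < u -> g u = 0}.
Proof.
apply: (@ae_eq0_of_primitive R g [set y : R | 0 < y] (- A)) => //.
  move=> y; apply: (@le_integrable _ _ _ mu _ _ _
    (fun u => (expR (p0 * y))%:E * (g u * expR (- (p0 * u)))%:E)%E) => //.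
  - by apply/measurable_EFinP; exact: measurable_funTS.
  - move=> u; rewrite /= in_itv/= => uy; rewrite lee_fin mulrCA -expRD normrM.
    rewrite ler_peMr// ger0_norm ?expR_ge0// -expR0 ler_expR -mulrBr mulr_ge0 ?subr_ge0//.
    by have [/ltW] := p0P (lexx p0).
  - by apply: integrableZl => //; apply: integrableS (intg (lexx p0)).
Qed.

(** The primitive of [g] equals [- A], yet [g] vanishes almost everywhere. *)
Let A_eq0 : A = 0.
Proof.
apply/eqP; rewrite -oppr_eq0 -(prim_g ltr01); apply/eqP.
rewrite /Rintegral (ae_eq_integral (cst 0%E)) ?integral0//.
  by apply/measurable_EFinP; exact: measurable_funTS.
have := ae_g_eq0; apply: filterS; first exact: (ae_filter_ringOfSetsType mu).
move=> u gu _; congr EFin; have [u0|u0] := ltP 0 u; first exact: gu.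
by rewrite /g /pos ltNge u0 !mul0r mulr0 !subr0.
Qed.

(** * Contraction near 0 and propagation by doubling *)

Let ind (v x : R) : R := ((0 < x) && (x <= v))%R%:R.

Let mind v : measurable_fun setT (ind v).
Proof.
apply: mbool; apply: measurable_and; first exact: measurable_fun_ltr.
exact: measurable_fun_ler.
Qed.

Let ind_ge0 v x : 0 <= ind v x. Proof. exact: ler0n. Qed.

Let N v := \int[mu]_x (`|f x| * ind v x).

Let int_ind v : mu.-integrable setT (EFin \o (fun x => f x * ind v x)).
Proof.
apply: (@dom _ 1 (expR v)) => // x.
rewrite ger0_norm// mul1r -expRD /ind; case: (leP x v) => xv.
  rewrite andbT (le_trans (y := 1)) ?lern1 ?leq_b1//.
  by rewrite -expR0 ler_expR subr_ge0.
by rewrite andbF expR_ge0.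
Qed.

Let int_abs_ind v : mu.-integrable setT (EFin \o (fun x => `|f x| * ind v x)).
Proof.
have := integrable_norm (int_ind v).
by apply: eq_integrable => // x _; rewrite /= normrM (ger0_norm (ind_ge0 _ _)).
Qed.

Let N_ge0 v : 0 <= N v.
Proof. by apply: Rintegral_ge0 => x _; rewrite mulr_ge0. Qed.

Let N_le v v' : v <= v' -> N v <= N v'.
Proof.
move=> vv'; apply: le_Rintegral => // x _; rewrite ler_wpM2l// ler_nat.
by rewrite /ind; case: (0 < x) => //=; case: (leP x v) => // xv; rewrite (le_trans xv vv').
Qed.

Let G_le u : 0 < u -> `|G u| <= N (u / 2).
Proof.
move=> u0; have -> : G u = \int[mu]_x (f x * ind (u / 2) x).
  rewrite -[RHS]add0r -A_eq0 -RintegralD//; apply: eq_Rintegral => x _.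
  rewrite -mulrDr /neg /ind; congr (_ * _).
  case: (leP x 0) => x0 /=; last by rewrite add0r.
  by rewrite (le_trans x0) ?addr0// divr_ge0// ltW.
apply: (le_trans (le_normr_Rintegral measurableT (int_ind _))).
rewrite le_eqVlt; apply/orP; left; apply/eqP; apply: eq_Rintegral => x _.
by rewrite normrM (ger0_norm (ind_ge0 _ _)).
Qed.

(** The equation [g = 0] integrated in absolute value over []0, d]]: the dilated term has integral
    exactly [N (d / 2)], and [G] is bounded there by [N (d / 2)], which costs a factor [d]. *)
Let N_ineq d : 0 < d ->
  2 * expR (- (`|a| * d)) * N d <= (1 + `|a| * d) * N (d / 2).
Proof.
move=> d0; pose phi u := `|f (u / 2)| * ind (d / 2) (u / 2) / 2.
have iphi : mu.-integrable setT (EFin \o phi).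
  have := integrableZl measurableT 2^-1 (integrable_half (int_abs_ind (d / 2))).
  by apply: eq_integrable => // u _; rewrite /= -EFinM mulrC.
have iind : mu.-integrable setT (EFin \o ind d).
  apply/integrableP; split; first by apply/measurable_EFinP; exact: mind.
  under eq_integral => u _ do rewrite /= ger0_norm// -[ind d u]mul1r.
  rewrite integral_mulb (_ : [set x : R | (0 < x) && (x <= d)] = `]0, d]%classic); last first.
    by apply/seteqP; split => x /=; rewrite in_itv.
  by rewrite integral_cst//= mul1e lebesgue_measure_itv/= lte_fin d0 -EFinB ltry.
have Rind : \int[mu]_u ind d u = d.
  rewrite /Rintegral; under eq_integral => u _ do rewrite -[ind d u]mul1r.
  rewrite integral_mulb (_ : [set x : R | (0 < x) && (x <= d)] = `]0, d]%classic); last first.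
    by apply/seteqP; split => x /=; rewrite in_itv.
  by rewrite integral_cst//= mul1e lebesgue_measure_itv/= lte_fin d0/= subr0.
pose c := `|a| * N (d / 2).
have ic : mu.-integrable setT (EFin \o (fun u => c * ind d u)).
  by have := integrableZl measurableT c iind; apply: eq_integrable.
have irhs : mu.-integrable setT (EFin \o (fun u => phi u + c * ind d u)).
  by have := integrableD measurableT iphi ic; apply: eq_integrable.
pose e := 2 * expR (- (`|a| * d)).
have ilhs : mu.-integrable setT (EFin \o (fun u => e * (`|f u| * ind d u))).
  by have := integrableZl measurableT e (int_abs_ind d); apply: eq_integrable.
have e0 : 0 <= e by rewrite mulr_ge0 ?expR_ge0.
have c0 : 0 <= c by rewrite mulr_ge0.
rewrite -/e -RintegralZl//.
have -> : (1 + `|a| * d) * N (d / 2) = \int[mu]_u (phi u + c * ind d u).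
  rewrite RintegralD// RintegralZl// Rind.
  by rewrite (Rintegral_half (int_abs_ind (d / 2))) -/(N _) /c; ring.
rewrite fine_le ?integrable_fin_num//.
apply: ae_ge0_le_integral => //.
- by move=> u _; rewrite lee_fin !mulr_ge0.
- by have /integrableP[] := ilhs.
- by move=> u _; rewrite lee_fin addr_ge0// mulr_ge0// !mulr_ge0.
- by have /integrableP[] := irhs.
have := ae_g_eq0; apply: filterS; first exact: (ae_filter_ringOfSetsType mu).
move=> u gu _; rewrite lee_fin /phi.
have -> : ind (d / 2) (u / 2) = ind d u.
  by rewrite /ind pmulr_lgt0 ?invr_gt0// ler_pM2r ?invr_gt0.
rewrite /ind; case: (boolP ((0 < u) && (u <= d))) => [/andP[u0 ud]|_] /=; last first.
  by rewrite !mulr0 mul0r addr0.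
rewrite !mulr1.
have fu : 2 * (expR (- (a * u)) * f u) = f (u / 2) / 2 + a * G u.
  have := gu u0; rewrite /g /pos u0 !mul1r => /eqP.
  by rewrite subr_eq0 subr_eq addrC => /eqP.
apply: (@le_trans _ _ `|2 * (expR (- (a * u)) * f u)|).
  rewrite !normrM (ger0_norm (expR_ge0 _)) normr_nat /e -mulrA ler_wpM2l// ler_wpM2r//.
  rewrite ler_expR lerN2 (le_trans (ler_norm _))// normrM ler_wpM2l//.
  by rewrite gtr0_norm.
rewrite fu (le_trans (ler_normD _ _))// normrM [`|_^-1|]ger0_norm ?invr_ge0// lerD2l.
rewrite normrM ler_wpM2l// (le_trans (G_le u0))// N_le//.
by rewrite ler_pM2r ?invr_gt0.
Qed.

Let N_eq0 v : N v = 0.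
Proof.
(* Chosen so that |a| d <= 1/4: the left factor of [N_ineq] is then at least 3/2 and the right one
   at most 5/4, so [N (d / 2) <= N d] forces [N d = 0]. *)
pose d := (4 * (`|a| + 1))^-1.
have na : 0 <= `|a| by [].
have d0 : 0 < d by rewrite invr_gt0 mulr_gt0//; lra.
have ad : `|a| * d <= 4^-1.
  rewrite /d invfM mulrCA ler_piMr ?invr_ge0// ler_pdivrMr; lra.
have Nd : N d = 0.
  apply/eqP; rewrite eq_le N_ge0 andbT.
  have := N_ineq d0; have := @N_le (d / 2) d.
  have -> : d / 2 <= d by lra.
  move=> /(_ isT); have := expR_ge1Dx (- (`|a| * d)); have := N_ge0 d; have := N_ge0 (d / 2).
  have : 0 <= `|a| * d by rewrite mulr_ge0// ltW.
  move=> K0 N20 N10 EK N21 H.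
  have H1 : 3 / 2 * N d <= 2 * expR (- (`|a| * d)) * N d by rewrite ler_wpM2r//; lra.
  have H2 : (1 + `|a| * d) * N (d / 2) <= 5 / 4 * N (d / 2) by rewrite ler_wpM2r//; lra.
  have H3 := le_trans H1 (le_trans H H2); lra.
(* Doubling requires no smallness: if [N] vanishes at half the length, the right side of [N_ineq] is
   0. *)
have N2 n : N (2 ^+ n * d) = 0.
  elim: n => [|n IH]; first by rewrite expr0 mul1r.
  have dn : 0 < 2 ^+ n.+1 * d by rewrite mulr_gt0// exprn_gt0.
  have := N_ineq dn; rewrite (_ : 2 ^+ n.+1 * d / 2 = 2 ^+ n * d); last by rewrite exprS; field.
  rewrite IH mulr0 pmulr_rle0; last by rewrite mulr_gt0// expR_gt0.
  by move=> N0; apply/eqP; rewrite eq_le N0 N_ge0.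
(* With this [n], v/d < n + 1 < 2^(n+1), so the doubled interval reaches past [v]. *)
apply/eqP; rewrite eq_le N_ge0 andbT; pose n := Num.truncn (v / d).
rewrite -(N2 n.+1) N_le// -ler_pdivrMr//.
rewrite (le_trans (ltW (truncnS_gt _)))//.
by rewrite -natrX ler_nat ltnW// ltn_expl.
Qed.

Lemma Va_inj_positive : {ae mu, forall x, 0 < x -> f x = 0}.
Proof.
have mfp : measurable_fun setT (fun x => `|f x| * pos x).
  by apply: measurable_funM => //; exact: measurableT_comp.
have fE y x : (((fun x => `|f x| * pos x) \_ `]-oo, y]) x) = `|f x| * ind y x.
  rewrite patchE; case: ifPn; rewrite ?inE ?notin_setE/= in_itv/= => xy.
    by rewrite /pos /ind xy andbT.
  by rewrite /ind (negbTE (introN idP xy)) andbF mulr0.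
have : {ae mu, forall x, setT x -> `|f x| * pos x = 0}.
  apply: (@ae_eq0_of_primitive R _ setT 0 mfp) => [y| |y _].
  - apply/(integrable_mkcond _ _).2 => //; rewrite restrict_EFin.
    rewrite (_ : _ \_ _ = fun x => `|f x| * ind y x); first exact: int_abs_ind.
    by apply/funext => x; exact: fE.
  - exact: openT.
  - rewrite Rintegral_mkcond -[RHS](N_eq0 y); apply: eq_Rintegral => x _.
    exact: fE.
apply: filterS; first exact: (ae_filter_ringOfSetsType mu).
move=> x + x0 => /(_ I); rewrite /pos x0 mulr1 => /eqP.
by rewrite normr_eq0 => /eqP.
Qed.

End Positive.

Theorem theorem1 (R : realType) (a taus L : R) (f : R -> R) :
  0 < taus -> 0 <= L -> L2 f ->
  {ae (@lebesgue_measure R), forall x, x < - L -> f x = 0} ->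
  {ae (@lebesgue_measure R), forall y, Va a taus f y = 0} ->
  {ae (@lebesgue_measure R), forall x, f x = 0}.
Proof.
move=> T0 _ [mf sqf] fL V0; have aeF := ae_filter_ringOfSetsType (@lebesgue_measure R).
(* The two half-line lemmas need support conditions at every point. [f1], and later [f2], satisfy
   them exactly while differing from [f] only on null sets. *)
pose f1 x := f x * (- L <= x)%R%:R.
have mb (P : R -> bool) : measurable_fun setT P ->
    measurable_fun setT (fun x => (P x)%:R : R).
  by move=> mP; apply: (measurableT_comp (f := fun b : bool => b%:R : R)).
have mf1 : measurable_fun setT f1.
  by apply: measurable_funM => //; apply: mb; apply: measurable_fun_ler.
have ff1 : {ae (@lebesgue_measure R), forall x, f x = f1 x}.
  move: fL; apply: filterS => x fx; rewrite /f1; case: (leP (- L) x) => xL /=.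
    by rewrite mulr1.
  by rewrite fx// mul0r.
have f1L x : x < - L -> f1 x = 0.
  by move=> xL; rewrite /f1 leNgt xL mulr0.
have f1_L2 : L2 f1.
  split=> //; apply: le_lt_trans sqf; apply: ge0_le_integral => //.
  - by move=> x _; rewrite lee_fin sqr_ge0.
  - by apply/measurable_EFinP; exact: measurable_funX.
  - by apply/measurable_EFinP; exact: measurable_funX.
  - move=> x _; rewrite lee_fin /f1 exprMn ler_piMr ?sqr_ge0// exprn_ile1//.
    by rewrite lern1 leq_b1.
have V1 : {ae (@lebesgue_measure R), forall y, Va a taus f1 y = 0}.
  by move: V0; apply: filterS => y <-; apply/esym/eq_Va_ae.
have intf1 k : 0 < k -> (@lebesgue_measure R).-integrable setT
    (EFin \o (fun x => f1 x * expR (- (k * x)))).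
  exact: L2_integrable_expR f1_L2 f1L.
have pos0 := Va_inj_positive T0 mf1 f1L intf1 V1.
pose f2 x := f1 x * (x <= 0)%R%:R.
have mf2 : measurable_fun setT f2.
  by apply: measurable_funM => //; apply: mb; apply: measurable_fun_ler.
have f12 : {ae (@lebesgue_measure R), forall x, f1 x = f2 x}.
  move: pos0; apply: filterS => x fx; rewrite /f2; case: (leP x 0) => x0 /=.
    by rewrite mulr1.
  by rewrite fx// mul0r.
have f2L x : x < - L -> f2 x = 0 by move=> xL; rewrite /f2 f1L// mul0r.
have f2_pos x : 0 < x -> f2 x = 0 by move=> x0; rewrite /f2 leNgt x0 mulr0.
have V2 : {ae (@lebesgue_measure R), forall y, Va a taus f2 y = 0}.
  by move: V1; apply: filterS => y <-; apply/esym/eq_Va_ae.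
(* On [x <= 0] the weight of rate 1 is at least 1, so integrability without weight follows. *)
have intf2 : (@lebesgue_measure R).-integrable setT (EFin \o f2).
  apply: le_integrable (intf1 1 ltr01) => //; first exact/measurable_EFinP.
  move=> x _; rewrite /= lee_fin /f2 !normrM ler_wpM2l// ger0_norm// ger0_norm ?expR_ge0//.
  case: (leP x 0) => x0 /=; last exact: expR_ge0.
  by rewrite -[leLHS]expR0 ler_expR mul1r oppr_ge0.
have neg0 := Va_inj_negative T0 mf2 intf2 f2L f2_pos V2.
(* The origin belongs to neither open half-line. *)
have z0 : {ae (@lebesgue_measure R), forall x : R, x != 0}.
  exists [set 0]; split; [exact: measurable_set1|exact: lebesgue_measure_set1|].
  by move=> x /= /negP; rewrite negbK => /eqP.
have ff2 : {ae (@lebesgue_measure R), forall x, f x = f2 x}.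
  by move: ff1 f12; apply: filterS2 => x ->.
move: ff2 neg0 z0; apply: filterS3 => x -> n0 x0.
by case: (ltgtP x 0) => [/n0//|/f2_pos//|xe]; rewrite xe eqxx in x0.
Qed.
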